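(* Let $D=\operatorname{diag}(\lambda_1,\dots,\lambda_n)$ with $\lambda_1>\dots>\lambda_n$ and let $\pi\in S_n$. Let $C\in\mathfrak{lo}$ and $M_0\in\mathcal U^{\mathbf{GL}}_{D^\pi}$ be constant matrices. The solution $M(t)$ of $$\dot M=[M,\Pi_{\mathfrak o}\,\mathcal C_Q(M,C)],\qquad M(0)=M_0,$$ is globally defined in $\mathcal U^{\mathbf{GL}}_{D^\pi}$. In linearizing coordinates, $D^\pi(t)=D^\pi(0)$, $Y(t)=Y(0)$ and $$Z(t)+D^\pi=L^{-1}(t)\,(Y(0)+D^\pi)\,L(t),\qquad L(t)=\exp(tC)\,L(0)\,\exp(-t\operatorname{diag}C).$$
   Context: All matrices are real $n\times n$; $\mathcal M$ is the space of all of them and $[A,B]=AB-BA$. $\mathfrak{lo}$ is the space of lower triangular matrices, $\mathfrak{lo}^0$ that of strictly lower triangular matrices, and $\operatorname{diag}C$ is the diagonal part of $C$. $P_\pi$ is the permutation matrix with $P_\pi e_i=e_{\pi(i)}$, and $D^\pi=P_\pi^\top DP_\pi=\operatorname{diag}(\lambda_{\pi(1)},\dots,\lambda_{\pi(n)})$. $\mathbf{GL}^{\mathrm{pos}}$ and $\mathbf O^{\mathrm{pos}}$ are the sets of invertible, respectively orthogonal, matrices all of whose leading principal minors are positive. $\mathcal U^{\mathbf{GL}}_{D^\pi}=\{X^{-1}D^\pi X : X\in\mathbf{GL}^{\mathrm{pos}}\}$. Each $M\in\mathcal U^{\mathbf{GL}}_{D^\pi}$ can be written uniquely as $M=Q^\top(Y+D^\pi)Q$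 with $Q\in\mathbf O^{\mathrm{pos}}$, $Y\in\mathfrak{lo}^0$; write uniquely $Q=LU$ with $L$ lower triangular with unit diagonal and $U$ upper triangular with positive diagonal, and define $Z\in\mathfrak{lo}^0$ by $Z+D^\pi=L^{-1}(Y+D^\pi)L$. The linearizing coordinates of $M$ are $(D^\pi,Y,Z)$. For $M(t)$, the corresponding matrices are denoted $Q(t),L(t),U(t),Y(t),Z(t)$. For $C\in\mathfrak{lo}$ set $\mathcal C_Q(M,C)=Q^\top CQ$. $\Pi_{\mathfrak o}:\mathcal M\to\mathfrak o$ is the projection associated with the direct sum $\mathcal M=\mathfrak o\oplus\mathfrak{up}$ of skew-symmetric and upper triangular matrices. *)

(* Defs.v *)
From HB Require Import structures.
From mathcomp Require Import all_boot all_order all_algebra all_fingroup.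
From mathcomp Require Import all_classical all_reals all_analysis.

Set Implicit Arguments.
Unset Strict Implicit.
Unset Printing Implicit Defensive.

Import Order.TTheory GRing.Theory Num.Theory.
Import numFieldNormedType.Exports.

Local Open Scope classical_set_scope.
Local Open Scope ring_scope.

Section MatrixSpaces.
Variables (R : realType) (n : nat).
Implicit Types (A B C X Q L U Y Z M : 'M[R]_n).

Definition bracket A B : 'M[R]_n := A *m B - B *m A.

(* MathComp's [is_trig_mx] means lower triangular. *)
Definition lower A : Prop := is_trig_mx A.
Definition upper A : Prop := is_trig_mx A^T.
Definition skew A : Prop := A^T = - A.
Definition strictly_lower A : Prop :=
  forall i j : 'I_n, (i <= j)%N -> A i j = 0.
Definition unit_lower A : Prop := lower A /\ forall i, A i i = 1.
Definition upper_pos A : Prop := upper A /\ forall i, 0 < A i i.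

Definition diag_part A : 'M[R]_n := diag_mx (\row_i A i i).

(* The minor on the rows and columns 0, ..., k. *)
Definition leading_minor A (k : 'I_n) : R :=
  \det (mxsub (widen_ord (ltn_ord k)) (widen_ord (ltn_ord k)) A).
Definition pos_leading_minors A : Prop := forall k, 0 < leading_minor A k.
Definition GLpos X : Prop := X \in unitmx /\ pos_leading_minors X.
Definition Opos Q : Prop := Q^T *m Q = 1%:M /\ pos_leading_minors Q.

(* Projection onto skew-symmetric matrices along upper triangular ones; the
   lemmas [proj_skewP] and [proj_skew_uniq] say that it is that projection. *)
Definition proj_skew A : 'M[R]_n :=
  \matrix_(i, j) (if (j < i)%N then A i j
                  else if (i < j)%N then - A j i else 0).

Lemma proj_skewP A : skew (proj_skew A) /\ upper (A - proj_skew A).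
Proof.
split.
  apply/matrixP => i j; rewrite !mxE.
  by case: ltngtP => _; rewrite ?opprK ?oppr0.
by apply/is_trig_mxP => i j lt_ij; rewrite !mxE lt_ij subrr.
Qed.

Lemma proj_skew_uniq A S : skew S -> upper (A - S) -> S = proj_skew A.
Proof.
move=> skS /is_trig_mxP upS.
have low (i j : 'I_n) : (j < i)%N -> S i j = A i j.
  by move=> /upS; rewrite !mxE => /eqP; rewrite subr_eq0 => /eqP.
have skE (i j : 'I_n) : S i j = - S j i.
  by have /matrixP/(_ j i) := skS; rewrite !mxE.
apply/matrixP => i j; rewrite mxE; case: ltngtP => [ji|ij|/val_inj ->].
- exact: low.
- by rewrite skE low.
- have /eqP := skE i i; rewrite -addr_eq0 -mulr2n mulrn_eq0 /=.
  by move/eqP.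
Qed.

(* No matrix exponential is available in the libraries: this is the sum of its
   power series, for the norm topology of matrices. *)
Definition mexp A : 'M[R]_n :=
  limn (series (fun k : nat => (k`!%:R : R)^-1 *: A ^+ k)).

(* P_pi e_i = e_(pi i) for column vectors, while [perm_mx] acts in this way on
   row vectors: hence the transpose. *)
Definition Pmx (pi : 'S_n) : 'M[R]_n := (perm_mx pi)^T.

Lemma Pmx_col (pi : 'S_n) (i : 'I_n) :
  Pmx pi *m (delta_mx i 0 : 'cV_n) = delta_mx (pi i) 0.
Proof.
apply/matrixP => a b; rewrite -colE !mxE.
by rewrite (ord1 b) eqxx andbT eq_sym.
Qed.

Definition Dpi (lam : 'rV[R]_n) (pi : 'S_n) : 'M[R]_n :=
  (Pmx pi)^T *m diag_mx lam *m Pmx pi.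

Lemma DpiE (lam : 'rV[R]_n) (pi : 'S_n) :
  Dpi lam pi = diag_mx (\row_i lam 0 (pi i)).
Proof.
rewrite /Dpi /Pmx trmxK tr_perm_mx -row_permE.
apply/matrixP => i j; rewrite -{1}[(pi^-1)%g]invgK -col_permE !mxE invgK.
by rewrite (inj_eq perm_inj).
Qed.

Definition UGL (lam : 'rV[R]_n) (pi : 'S_n) : set 'M[R]_n :=
  [set invmx X *m Dpi lam pi *m X | X in GLpos].

End MatrixSpaces.

(* The linearizing coordinates (D^pi, Y, Z) of a matrix together with the
   auxiliary factors Q, L, U that determine them. *)
Record lin_data (R : realType) (n : nat) := LinData {
  lin_D : 'M[R]_n;
  lin_Q : 'M[R]_n;
  lin_Y : 'M[R]_n;
  lin_L : 'M[R]_n;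
  lin_U : 'M[R]_n;
  lin_Z : 'M[R]_n }.

HB.instance Definition _ (R : realType) (n : nat) :=
  gen_eqMixin (lin_data R n).
HB.instance Definition _ (R : realType) (n : nat) :=
  gen_choiceMixin (lin_data R n).
HB.instance Definition _ (R : realType) (n : nat) :=
  isPointed.Build (lin_data R n) (LinData 0 0 0 0 0 0).

Section Flow.
Variables (R : realType) (n : nat).
Implicit Types (lam : 'rV[R]_n) (pi : 'S_n) (M C : 'M[R]_n).

Definition is_lin_data lam pi M (d : lin_data R n) : Prop :=
  let: LinData D Q Y L U Z := d in
  [/\ D = Dpi lam pi,
      Opos Q /\ strictly_lower Y,
      M = Q^T *m (Y + D) *m Q,
      [/\ unit_lower L, upper_pos U & Q = L *m U] &
      strictly_lower Z /\ Z + D = invmx L *m (Y + D) *m L].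

(* The unique such data when M is in [UGL lam pi] and the entries of lam are
   distinct; a dummy value if there is none. *)
Definition lin_data_of lam pi M : lin_data R n :=
  get [set d | is_lin_data lam pi M d].

Definition CQ lam pi M C : 'M[R]_n :=
  let Q := lin_Q (lin_data_of lam pi M) in Q^T *m C *m Q.

(* M solves the initial value problem in UGL on the open interval J. *)
Definition solves lam pi C M0 (J : set R) (M : R -> 'M[R]_n) : Prop :=
  M 0 = M0 /\
  forall t, J t -> UGL lam pi (M t) /\
    is_derive t (1 : R) M (bracket (M t) (proj_skew (CQ lam pi (M t) C))).

End Flow.

(* Main.v *)
(** Let [L(t) = exp(tC) L(0) exp(-t diag C)], a lower unitriangular solution of
    [L' = C L - L diag C], and let [L(t) = Q(t) S(t)] be its QR factorization.
    Comparing [L'] with [(Q S)'] modulo upper triangular matrices gives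
    [Q' = Q A] with [A] the skew-symmetric projection of [Q^T C Q], hence
    [M = Q^T (Y + D) Q], with [Y] constant, solves the equation.

    Conversely let [N] be a solution in [UGL], with data [Q, Y, L, U].  The
    flags of invariant subspaces of [N] are obtained from polynomials in [N], so
    [Q] is differentiable.  Then [S = Q' Q^T - Q A Q^T] is skew-symmetric and
    [[S, Y + D] = Y'] is strictly lower triangular; as [Y + D] is lower
    triangular with distinct diagonal entries, [S] is lower triangular too, so
    [S = 0], [Y' = 0] and [Q' = Q A].  Consequently [L' = C L - L diag C], which
    determines [L], then [Q] and [N]: no Lipschitz estimate is needed. *)

Require Import Defs.
From mathcomp Require Import all_boot all_order all_algebra all_fingroup.
From mathcomp Require Import all_classical all_reals all_analysis.
From mathcomp Require Import ring zify.

Set Implicit Arguments.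
Unset Strict Implicit.
Unset Printing Implicit Defensive.

Import Order.TTheory GRing.Theory Num.Theory.
Import numFieldNormedType.Exports.

Local Open Scope classical_set_scope.
Local Open Scope ring_scope.

(** * Triangular matrices and factorizations *)

Section Triangular.
Variables (R : realType) (n : nat).
Implicit Types (A B L U Q S T : 'M[R]_n).

Lemma lowerP A : lower A <-> forall i j : 'I_n, (i < j)%N -> A i j = 0.
Proof. by split=> [/is_trig_mxP|h]; [|apply/is_trig_mxP]. Qed.

Lemma upperP A : upper A <-> forall i j : 'I_n, (j < i)%N -> A i j = 0.
Proof.
split=> [/lowerP h i j ji|h]; first by have := h _ _ ji; rewrite mxE.
by apply/lowerP => i j ij; rewrite mxE h.
Qed.

Lemma lower_tr A : lower A -> upper A^T.
Proof. by rewrite /upper trmxK. Qed.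

Lemma lower1 : lower (1%:M : 'M[R]_n).
Proof. exact: scalar_mx_is_trig. Qed.

Lemma lowerD A B : lower A -> lower B -> lower (A + B).
Proof.
by move=> /lowerP hA /lowerP hB; apply/lowerP => i j ij; rewrite mxE hA ?hB ?addr0.
Qed.

Lemma lowerN A : lower A -> lower (- A).
Proof. by move=> /lowerP hA; apply/lowerP => i j ij; rewrite mxE hA ?oppr0. Qed.

Lemma lower_mul A B : lower A -> lower B -> lower (A *m B).
Proof.
move=> /lowerP hA /lowerP hB; apply/lowerP => i j ij; rewrite mxE big1// => k _.
have [ik|ki] := ltnP i k; first by rewrite hA ?mul0r.
by rewrite hB ?mulr0// (leq_ltn_trans ki).
Qed.

Lemma lower_mul_diag A B i : lower A -> lower B -> (A *m B) i i = A i i * B i i.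
Proof.
move=> /lowerP hA /lowerP hB; rewrite mxE (bigD1 i)//= big1 ?addr0// => k.
rewrite -val_eqE neq_ltn => /orP[ki|ik]; first by rewrite hB ?mulr0.
by rewrite hA ?mul0r.
Qed.

Lemma upper_mul A B : upper A -> upper B -> upper (A *m B).
Proof. by move=> hA hB; rewrite /upper trmx_mul; exact: lower_mul. Qed.

Lemma upper_mul_diag A B i : upper A -> upper B -> (A *m B) i i = A i i * B i i.
Proof.
move=> hA hB; have := lower_mul_diag i hB hA.
by rewrite -trmx_mul !mxE mulrC.
Qed.

Lemma lower_unit A : lower A -> (forall i, A i i != 0) -> A \in unitmx.
Proof.
move=> lA nz; rewrite unitmxE det_trig// unitfE; apply/prodf_neq0 => i _.
exact: nz.
Qed.

Lemma upper_unit A : upper A -> (forall i, A i i != 0) -> A \in unitmx.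
Proof. by move=> uA nz; rewrite -unitmx_tr lower_unit// => i; rewrite mxE. Qed.

(* Solving [S *m T - T' *m S = E] entry by entry, starting at the top right
   corner. *)
Lemma sylvester_lower T T' S : lower T -> lower T' ->
  (forall i j : 'I_n, (i < j)%N -> T j j != T' i i) ->
  (forall i j : 'I_n, (i < j)%N -> (S *m T - T' *m S) i j = 0) -> lower S.
Proof.
move=> /lowerP lT /lowerP lT' neq E0; apply/lowerP => i j.
have [m] := ubnP (n - j + i)%N; elim: m i j => // m IH i j lem ij.
have := E0 _ _ ij; rewrite !mxE (bigD1 j)//= [X in _ - X](bigD1 i)//=.
rewrite [X in _ + X - _]big1 => [|k]; last first.
  rewrite -val_eqE neq_ltn => /orP[kj|jk]; first by rewrite lT ?mulr0.
  rewrite IH ?mul0r ?(ltn_trans ij)//.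
  by rewrite (leq_trans _ (lem : (_ <= m)%N))// ltn_add2r ltn_sub2l.
rewrite [X in _ - (_ + X)]big1 => [|k]; last first.
  rewrite -val_eqE neq_ltn => /orP[ki|ik]; last by rewrite lT' ?mul0r.
  rewrite IH ?mulr0 ?(ltn_trans _ ij)//.
  by rewrite (leq_trans _ (lem : (_ <= m)%N))// ltn_add2l.
rewrite !addr0 [T' i i * _]mulrC -mulrBr => /eqP; rewrite mulf_eq0 subr_eq0.
by rewrite (negPf (neq _ _ ij)) orbF => /eqP.
Qed.

(** Induction on the row: in entry (i, j) of [A *m invmx A = 1%:M] with i < j, terms of smaller
    index vanish by induction and terms of larger index by triangularity, leaving [A i i] times the
    entry sought. *)
Lemma lower_inv A : lower A -> (forall i, A i i != 0) -> lower (invmx A).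
Proof.
move=> lA nz; have uA := lower_unit lA nz.
apply/lowerP => i j; elim/ltn_ind: {i}(val i) {-2}i (erefl (val i)) => m IH i im ij.
have := mulmxV uA => /matrixP/(_ i j); rewrite !mxE (bigD1 i)//= big1 => [|k].
  rewrite -val_eqE ltn_eqF// addr0 => /eqP.
  by rewrite mulf_eq0 (negPf (nz i)) => /eqP.
rewrite -val_eqE neq_ltn => /orP[ki|ik]; last by rewrite (lowerP A).1 ?mul0r.
by rewrite (IH (val k)) ?mulr0 -?im// (ltn_trans ki).
Qed.

Lemma lower_inv_diag A i : lower A -> (forall i, A i i != 0) ->
  (invmx A) i i = (A i i)^-1.
Proof.
move=> lA nz; have := mulmxV (lower_unit lA nz) => /matrixP/(_ i i).
rewrite lower_mul_diag//; last exact: lower_inv.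
rewrite mxE eqxx => h; apply: (mulfI (nz i)); rewrite h mulfV//; exact: nz.
Qed.

Lemma upper_inv A : upper A -> (forall i, A i i != 0) -> upper (invmx A).
Proof.
by move=> uA nz; rewrite /upper trmx_inv; apply: lower_inv => // i; rewrite mxE.
Qed.

Lemma upper_inv_diag A i : upper A -> (forall i, A i i != 0) ->
  (invmx A) i i = (A i i)^-1.
Proof.
move=> uA nz; have := @lower_inv_diag A^T i uA.
by rewrite -trmx_inv !mxE => -> // j; rewrite mxE.
Qed.

Lemma unit_lower_neq0 L : unit_lower L -> forall i, L i i != 0.
Proof. by case=> _ h i; rewrite h oner_neq0. Qed.

Lemma unit_lower_unit L : unit_lower L -> L \in unitmx.
Proof. by move=> hL; apply: lower_unit (unit_lower_neq0 hL); case: hL. Qed.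

Lemma unit_lower_inv L : unit_lower L -> unit_lower (invmx L).
Proof.
move=> hL; have nz := unit_lower_neq0 hL; case: (hL) => lL dL.
by split=> [|i]; rewrite ?lower_inv_diag ?dL ?invr1//; apply: lower_inv.
Qed.

Lemma unit_lower_mul L L' : unit_lower L -> unit_lower L' -> unit_lower (L *m L').
Proof.
move=> [lL dL] [lL' dL']; split=> [|i]; first exact: lower_mul.
by rewrite lower_mul_diag// dL dL' mulr1.
Qed.

Lemma upper_pos_neq0 U : upper_pos U -> forall i, U i i != 0.
Proof. by case=> _ h i; rewrite gt_eqF. Qed.

Lemma upper_pos_unit U : upper_pos U -> U \in unitmx.
Proof. by move=> hU; apply: upper_unit (upper_pos_neq0 hU); case: hU. Qed.

Lemma upper_pos_inv U : upper_pos U -> upper_pos (invmx U).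
Proof.
move=> hU; have nz := upper_pos_neq0 hU; case: (hU) => uU dU.
by split=> [|i]; rewrite ?upper_inv_diag ?invr_gt0//; apply: upper_inv.
Qed.

Lemma upper_pos_mul U V : upper_pos U -> upper_pos V -> upper_pos (U *m V).
Proof.
move=> [uU dU] [uV dV]; split=> [|i]; first exact: upper_mul.
by rewrite upper_mul_diag// mulr_gt0.
Qed.

Lemma strictly_lower_subP A B : lower A -> lower B ->
  (forall i, A i i = B i i) -> strictly_lower (A - B).
Proof.
move=> /lowerP lA /lowerP lB d i j; rewrite leq_eqVlt !mxE => /orP[/eqP/val_inj <-|ij].
  by rewrite d subrr.
by rewrite lA ?lB ?subrr.
Qed.

Lemma strictly_lower_lower A : strictly_lower A -> lower A.
Proof. by move=> h; apply/lowerP => i j /ltnW; exact: h. Qed.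

(** The quotient [invmx L' *m L = U' *m invmx U] is both lower unitriangular and upper triangular,
    hence the identity. *)
Lemma LU_unique L U L' U' : unit_lower L -> unit_lower L' ->
  upper_pos U -> upper_pos U' -> L *m U = L' *m U' -> L = L' /\ U = U'.
Proof.
move=> hL hL' hU hU' e.
have uL := unit_lower_unit hL; have uU := upper_pos_unit hU.
have eK : invmx L' *m L = U' *m invmx U.
  by apply: (canRL (mulmxK uU)); rewrite -mulmxA e mulKmx// unit_lower_unit.
have [lK dK] := unit_lower_mul (unit_lower_inv hL') hL.
have [uK _] := upper_pos_mul hU' (upper_pos_inv hU); rewrite -eK in uK.
have K1 : invmx L' *m L = 1%:M.
  apply/matrixP => i j; rewrite [RHS]mxE -val_eqE; case: ltngtP => [ij|ji|/val_inj ->].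
  - exact: (lowerP _).1.
  - exact: (upperP _).1.
  - exact: dK.
have eL : L = L' by rewrite -[L](mulKVmx (unit_lower_unit hL')) K1 mulmx1.
by split=> //; move: e; rewrite -eL => /(can_inj (mulKmx uL)).
Qed.

(** * Leading minors and the LU factorization *)

Lemma leading_minor_lower_mul B A k : lower B ->
  leading_minor (B *m A) k =
  (\prod_(i < k.+1) B (widen_ord (ltn_ord k) i) (widen_ord (ltn_ord k) i))
    * leading_minor A k.
Proof.
move=> /lowerP lB; rewrite /leading_minor; set f := widen_ord _.
(* Rows of index at most [k] of [B] vanish beyond column [k], so the leading block of the product is
   the product of the leading blocks. *)
have -> : mxsub f f (B *m A) = mxsub f f B *m mxsub f f A.
  apply/matrixP => a b; rewrite !mxE.
  under [RHS]eq_bigr => l _ do rewrite !mxE.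
  rewrite -(big_ord_narrow (F := fun l => B (f a) l * A l (f b)) (ltn_ord k)).
  rewrite [LHS](bigID (fun l : 'I_n => (l < k.+1)%N))/= [X in _ + X]big1 ?addr0//.
  move=> l; rewrite -leqNgt => kl; rewrite lB ?mul0r//=.
  exact: leq_trans (ltn_ord a) kl.
rewrite det_mulmx det_trig; last first.
  by apply/is_trig_mxP => a b ab; rewrite mxE lB.
by congr (_ * _); apply: eq_bigr => i _; rewrite mxE.
Qed.

(** Zeros are required only inside the leading block, which is what a partial elimination
    provides. *)
Lemma leading_minor_upper U (k : 'I_n) :
  (forall i j : 'I_n, (j < i <= k)%N -> U i j = 0) ->
  leading_minor U k =
  \prod_(i < k.+1) U (widen_ord (ltn_ord k) i) (widen_ord (ltn_ord k) i).
Proof.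
move=> uU; rewrite /leading_minor -det_tr det_trig; last first.
  by apply/is_trig_mxP => a b ab; rewrite !mxE uU//= ab -ltnS ltn_ord.
by apply: eq_bigr => i _; rewrite !mxE.
Qed.

Lemma pos_leading_minors_lower_mul B A : lower B -> (forall i, 0 < B i i) ->
  pos_leading_minors A -> pos_leading_minors (B *m A).
Proof.
by move=> lB pB pA k; rewrite leading_minor_lower_mul// mulr_gt0// prodr_gt0.
Qed.

Lemma pos_leading_minors_upper U : upper_pos U -> pos_leading_minors U.
Proof.
move=> [uU pU] k; rewrite leading_minor_upper ?prodr_gt0// => i j /andP[ji _].
exact: (upperP U).1.
Qed.

(** [d k] is the quotient of two consecutive prefix products, both positive. *)
Lemma gt0_of_prod_prefix (d : 'I_n -> R) (k : 'I_n) :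
  (forall j : 'I_n, (j <= k)%N ->
    0 < \prod_(i < j.+1) d (widen_ord (ltn_ord j) i)) -> 0 < d k.
Proof.
(* [b] extends [d] by 1 to all naturals, so that the prefix products become products of a single
   sequence. *)
move=> pd; pose b m := if insub m is Some i then d i else 1.
have bE (j : 'I_n) (i : 'I_j.+1) : b i = d (widen_ord (ltn_ord j) i).
  rewrite /b insubT /=; first by rewrite (leq_trans (ltn_ord i)).
  by move=> h; congr d; apply/val_inj.
have prod_gt0 m : (m <= k.+1)%N -> 0 < \prod_(i < m) b i.
  case: m => [|m] mk; first by rewrite big_ord0.
  have mn : (m < n)%N by rewrite (leq_trans mk).
  by rewrite (eq_bigr _ (fun i _ => bE (Ordinal mn) i)) pd.
have := prod_gt0 _ (leqnn k.+1); rewrite big_ord_recr/=.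
rewrite pmulr_rgt0 ?prod_gt0// (bE k ord_max).
by congr (0 < d _); apply/val_inj.
Qed.

(** Dividing the leading minors of [B *m A] by those of [A] leaves the prefix products of the
    diagonal of [B]. *)
Lemma pos_diag_of_minors B A : lower B -> pos_leading_minors A ->
  pos_leading_minors (B *m A) -> forall i, 0 < B i i.
Proof.
move=> lB pA pBA k; apply: (@gt0_of_prod_prefix (fun i => B i i)) => j _.
by have := pBA j; rewrite leading_minor_lower_mul// pmulr_lgt0.
Qed.

(** Gaussian elimination without row exchanges. The hypothesis speaks of every unitriangular [L]
    that clears the first [k] columns, so that it can be checked independently of the elimination,
    both for positive leading minors and for Gram matrices. *)
Lemma LU_of_pivots A :
  (forall L (k : 'I_n), unit_lower L ->
    (forall i j : 'I_n, (j < k)%N -> (j < i)%N -> (L *m A) i j = 0) ->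
    0 < (L *m A) k k) ->
  exists L U, [/\ unit_lower L, upper_pos U & A = L *m U].
Proof.
move=> piv.
have elim m : (m <= n)%N -> exists2 L, unit_lower L &
    forall i j : 'I_n, (j < m)%N -> (j < i)%N -> (L *m A) i j = 0.
  elim: m => [_|m IH mn]; first by exists 1%:M => //; split=> [|i];
    [exact: lower1|rewrite mxE eqxx].
  have [L hL zL] := IH (ltnW mn).
  have [k km] : exists k : 'I_n, k = m :> nat by exists (Ordinal mn).
  rewrite -{m IH mn}km in zL *.
  have pk := piv L k hL zL; set B := L *m A in zL pk.
  (* [c] holds the multipliers for column [k]; [E] subtracts from each row below [k] its multiple of
     row [k]. *)
  pose c := \col_i (if (k < i)%N then B i k / B k k else 0) : 'cV[R]_n.
  pose E := 1%:M - c *m delta_mx 0 k.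
  have EE i j : E i j =
      (i == j)%:R - (if (k < i)%N then B i k / B k k else 0) * (j == k)%:R.
    by rewrite !mxE big_ord1 !mxE eqxx.
  have hE : unit_lower E.
    split=> [|i].
      apply/lowerP => i j ij; rewrite EE -val_eqE ltn_eqF//= sub0r.
      case: ifP => ki; rewrite ?mul0r ?oppr0//.
      by rewrite -val_eqE gtn_eqF ?mulr0 ?oppr0// (ltn_trans ki).
    rewrite EE eqxx; case: (ltnP k i) => ki; last by rewrite mul0r subr0.
    by rewrite -val_eqE gtn_eqF// mulr0 subr0.
  have EX X i j : (E *m X) i j =
      X i j - (if (k < i)%N then B i k / B k k else 0) * X k j.
    by rewrite mulmxBl mul1mx -mulmxA -rowE !mxE big_ord1 !mxE.
  exists (E *m L); first exact: unit_lower_mul.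
  move=> i j; rewrite ltnS -mulmxA -/B EX leq_eqVlt => /orP[/eqP/val_inj ->|jk] ji.
    by rewrite ji divfK ?subrr// gt_eqF.
  by rewrite (zL i j)// (zL k j)// mulr0 subrr.
have [L hL zL] := elim n (leqnn n).
exists (invmx L), (L *m A); split; first exact: unit_lower_inv.
  split; first by apply/upperP => i j ji; exact: zL.
  by move=> i; apply: piv => // ? ? ? ; exact: zL.
by rewrite mulKmx// unit_lower_unit.
Qed.

(** Multiplication by [L] keeps the leading minors positive, and after clearing they are the prefix
    products of the pivots. *)
Lemma LU_exists A : pos_leading_minors A ->
  exists L U, [/\ unit_lower L, upper_pos U & A = L *m U].
Proof.
move=> pA; apply: LU_of_pivots => L k [lL dL] zL.
have pLA : pos_leading_minors (L *m A).
  by apply: pos_leading_minors_lower_mul => // i; rewrite dL.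
apply: (@gt0_of_prod_prefix (fun i => (L *m A) i i)) => j jk.
have := pLA j; rewrite leading_minor_upper// => a b /andP[ba aj].
by apply: zL => //; rewrite (leq_trans ba)// (leq_trans aj).
Qed.

(** * The QR factorization *)

Lemma row_sqr_gt0 A i : A \in unitmx -> 0 < (A *m A^T) i i.
Proof.
move=> uA; rewrite lt_neqAle mxE sumr_ge0 ?andbT; last first.
  by move=> k _; rewrite mxE -expr2 sqr_ge0.
apply/eqP => /esym/psumr_eq0P z.
have Ai k : A i k = 0.
  apply/eqP; rewrite -sqrf_eq0 expr2; have := z _ k isT; rewrite mxE => ->// j _.
  by rewrite mxE -expr2 sqr_ge0.
have := mulmxV uA => /matrixP/(_ i i); rewrite !mxE eqxx big1; last first.
  by move=> k _; rewrite Ai mul0r.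
by move/esym/eqP; rewrite oner_eq0.
Qed.

(* The Gram matrix [A^T *m A] is positive definite, so its elimination has
   positive pivots and yields its Cholesky factorization. *)
Lemma QR_exists A : A \in unitmx ->
  exists Q S, [/\ Q^T *m Q = 1%:M, upper_pos S & A = Q *m S].
Proof.
move=> uA; pose G := A^T *m A.
have [|L [U [hL hU eG]]] := @LU_of_pivots G.
  move=> L k hL zL; have [lL dL] := hL.
  (* The pivot [(L *m G) k k] is the diagonal entry of [L *m G *m L^T], since row [k] of [L *m G] is
     cleared before column [k] and column [k] of [L^T] vanishes below it. That entry is the squared
     norm of a row of [L *m A^T]. *)
  have := @row_sqr_gt0 (L *m A^T) k.
  rewrite unitmx_mul unit_lower_unit// unitmx_tr => /(_ uA).
  rewrite trmx_mul trmxK mulmxA -(mulmxA L) -/G mxE (bigD1 k)//= big1 ?addr0.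
    by rewrite [L^T _ _]mxE dL mulr1.
  move=> j; rewrite -val_eqE neq_ltn => /orP[jk|kj]; first by rewrite zL ?mul0r.
  by rewrite [L^T _ _]mxE (lowerP L).1 ?mulr0.
have [lL dL] := hL; have [uU pU] := hU.
pose Lt := invmx L^T.
have hLt : upper_pos Lt.
  by apply: upper_pos_inv; split=> [|i]; [exact: lower_tr|rewrite mxE dL].
have uL := unit_lower_unit hL; have uLt : L^T \in unitmx by rewrite unitmx_tr.
have UE : U *m Lt = (invmx L *m A^T) *m (invmx L *m A^T)^T.
  by rewrite trmx_mul trmxK trmx_inv mulmxA -(mulmxA (invmx L)) -/G eG mulKmx.
have [uULt _] := upper_pos_mul hU hLt.
(* This product is upper triangular and, by [UE], symmetric. *)
have ULtE : U *m Lt = diag_mx (\row_i U i i).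
  apply/matrixP => i j; rewrite [RHS]mxE [X in X *+ _]mxE -val_eqE.
  case: ltngtP => [ij|ji|/val_inj <-].
  - have /matrixP/(_ i j) : (U *m Lt)^T = U *m Lt by rewrite UE trmx_mul trmxK.
    by rewrite mxE => <-; rewrite ((upperP _).1 uULt).
  - by rewrite ((upperP _).1 uULt).
  - rewrite upper_mul_diag//; last by case: hLt.
    rewrite upper_inv_diag ?[L^T _ _]mxE ?dL ?invr1 ?mulr1 ?mulr1n//.
      exact: lower_tr.
    by move=> k; rewrite mxE dL oner_neq0.
(* Thus [G] is [L] times a positive diagonal matrix times [L^T]; distributing the square root of the
   diagonal gives the Cholesky factor [sq *m L^T], and the orthogonal factor is [A] times its
   inverse. *)
pose sq := diag_mx (\row_i Num.sqrt (U i i)).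
pose sqi := diag_mx (\row_i (Num.sqrt (U i i))^-1).
have sqK : sqi *m sq = 1%:M.
  rewrite mulmx_diag -diag_const_mx; congr diag_mx; apply/rowP => i.
  by rewrite !mxE mulVf// gt_eqF// sqrtr_gt0.
exists (A *m Lt *m sqi), (sq *m L^T); split.
- rewrite trmx_mul tr_diag_mx trmx_mul.
  have -> : sqi *m (Lt^T *m A^T) *m (A *m Lt *m sqi) = sqi *m (Lt^T *m G *m Lt) *m sqi.
    by rewrite !mulmxA.
  rewrite eG trmx_inv trmxK mulKmx// ULtE.
  rewrite !mulmx_diag -diag_const_mx; congr diag_mx; apply/rowP => i.
  rewrite !mxE mulrAC -invfM -expr2 sqr_sqrtr ?ltW// mulVf// gt_eqF//.
- have usq : upper sq by rewrite /upper tr_diag_mx diag_mx_is_trig.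
  split=> [|i]; first exact: upper_mul (lower_tr lL).
  rewrite upper_mul_diag//; last exact: lower_tr.
  by rewrite !mxE eqxx mulr1n dL mulr1 sqrtr_gt0.
- by rewrite mulmxA -(mulmxA _ sqi) sqK mulmx1 mulmxKV.
Qed.

(** The inverse of [S] is upper triangular and equals [S^T], so [S] is diagonal with positive
    entries of square 1. *)
Lemma upper_orthogonal S : upper_pos S -> S^T *m S = 1%:M -> S = 1%:M.
Proof.
move=> hS /(congr1 (mulmx^~ (invmx S))); rewrite mulmxK ?upper_pos_unit// mul1mx => e.
have [uS pS] := hS; have [uSi _] := upper_pos_inv hS; rewrite -e in uSi.
apply/matrixP => i j; rewrite [RHS]mxE -val_eqE; case: ltngtP => [ij|ji|/val_inj <-].
- by have := (upperP _).1 uSi j i ij; rewrite mxE.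
- exact: (upperP _).1.
- have /matrixP/(_ i i) := e; rewrite mxE upper_inv_diag//; last exact: upper_pos_neq0.
  move=> /(congr1 ( *%R^~ (S i i))); rewrite mulVf ?upper_pos_neq0// -expr2 => /eqP.
  by rewrite sqrp_eq1 ?ltW// => /eqP.
Qed.

Lemma QR_unique Q S Q' S' : Q^T *m Q = 1%:M -> Q'^T *m Q' = 1%:M ->
  upper_pos S -> upper_pos S' -> Q *m S = Q' *m S' -> Q = Q' /\ S = S'.
Proof.
move=> oQ oQ' hS hS' e.
have uS := upper_pos_unit hS.
have eQ : Q = Q' *m (S' *m invmx S) by rewrite mulmxA -e mulmxK.
have hK := upper_pos_mul hS' (upper_pos_inv hS).
have K1 : S' *m invmx S = 1%:M.
  apply: upper_orthogonal => //.
  by move: oQ; rewrite eQ trmx_mul mulmxA -(mulmxA _ Q'^T) oQ' mulmx1.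
by split; [rewrite eQ K1 mulmx1|rewrite -[S'](mulmxKV uS) K1 mul1mx].
Qed.

End Triangular.

(** * Derivatives of matrix functions and the matrix exponential *)

Section MatrixLimits.
Variables (R : realType).

Lemma cvg_mxP m n (u : nat -> 'M[R]_(m, n))
    (l : 'M[R]_(m, n)) :
  u @ \oo --> l <-> forall i j, u k i j @[k --> \oo] --> l i j.
Proof.
split=> [ul i j|ul].
  apply/cvgrPdist_le => e e0; move/cvgrPdist_le : ul => /(_ _ e0).
  apply: filterS => k; apply: le_trans.
  rewrite [leRHS]/Num.Def.normr/= mx_normrE.
  by apply: le_trans (le_bigmax _ _ (i, j)); rewrite !mxE.
apply/cvgrPdist_le => /= e e0; near=> k.
rewrite /Num.Def.normr/= mx_normrE (bigmax_le _ (ltW e0))//= => i _.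
rewrite !mxE; move: i; near: k; apply: filter_forall => /= i.
exact: ((cvgrPdist_le _ _).1 (ul i.1 i.2)).
Unshelve. all: by end_near. Qed.

Lemma cvg_sumr n (u : 'I_n -> nat -> R)
    (l : 'I_n -> R) : (forall i, u i k @[k --> \oo] --> l i) ->
  \sum_i u i k @[k --> \oo] --> \sum_i l i.
Proof.
by move=> ul; apply: cvg_big => [|i _]; [exact: add_continuous|exact: ul].
Qed.

Lemma cvg_mulmxl m n p (B : 'M[R]_(m, n))
    (u : nat -> 'M[R]_(n, p)) (l : 'M[R]_(n, p)) :
  u @ \oo --> l -> B *m u k @[k --> \oo] --> B *m l.
Proof.
move=> /cvg_mxP ul; apply/cvg_mxP => i j; rewrite mxE.
under eq_fun do rewrite mxE.
by apply: cvg_sumr => k; apply: cvgMl_tmp; exact: ul.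
Qed.

Lemma cvg_mulmxr m n p (B : 'M[R]_(n, p))
    (u : nat -> 'M[R]_(m, n)) (l : 'M[R]_(m, n)) :
  u @ \oo --> l -> u k *m B @[k --> \oo] --> l *m B.
Proof.
move=> /cvg_mxP ul; apply/cvg_mxP => i j; rewrite mxE.
under eq_fun do rewrite mxE.
by apply: cvg_sumr => k; apply: cvgMr_tmp; exact: ul.
Qed.

End MatrixLimits.

Section MatrixDerivatives.
Variables (R : realType).

Lemma is_derive_mxP m n (M : R -> 'M[R]_(m, n)) t D :
  is_derive t (1 : R) M D <->
  forall i j, is_derive t (1 : R) (fun s => M s i j) (D i j).
Proof.
split=> [[dM <-] i j|h].
  apply: DeriveDef; first exact: (derivable_mxP _ _ _).1 dM i j.
  by rewrite derive_mx// mxE.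
have dM : derivable M t 1 by apply: (derivable_mxP _ _ _).2 => i j; case: (h i j).
apply: DeriveDef => //; apply/matrixP => i j; rewrite derive_mx// mxE.
by case: (h i j).
Qed.

Lemma is_derive_mulr (f g : R -> R) t (df dg : R) :
  is_derive t (1 : R) f df -> is_derive t (1 : R) g dg ->
  is_derive t (1 : R) (fun s => f s * g s) (df * g t + f t * dg).
Proof.
move=> hf hg; apply: is_derive_eq (is_deriveM hf hg) _.
by rewrite addrC; congr (_ + _); exact: mulrC.
Qed.

Lemma is_derive_sumr n (f : 'I_n -> R -> R) t (df : 'I_n -> R) :
  (forall i, is_derive t (1 : R) (f i) (df i)) ->
  is_derive t (1 : R) (fun s => \sum_i f i s) (\sum_i df i).
Proof.
move=> h; have := is_derive_sum h.
by congr is_derive; apply/funext => s; rewrite fct_sumE.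
Qed.

Lemma is_derive_mulmx m n p (A : R -> 'M[R]_(m, n)) (B : R -> 'M[R]_(n, p)) t dA dB :
  is_derive t (1 : R) A dA -> is_derive t (1 : R) B dB ->
  is_derive t (1 : R) (fun s => A s *m B s) (dA *m B t + A t *m dB).
Proof.
move=> /is_derive_mxP hA /is_derive_mxP hB; apply/is_derive_mxP => i j.
under eq_fun do rewrite mxE.
rewrite !mxE -big_split/=; apply: is_derive_sumr => k.
exact: is_derive_mulr.
Qed.

Lemma is_derive_trmx m n (A : R -> 'M[R]_(m, n)) t dA :
  is_derive t (1 : R) A dA -> is_derive t (1 : R) (fun s => (A s)^T) dA^T.
Proof.
move=> /is_derive_mxP hA; apply/is_derive_mxP => i j.
by under eq_fun do rewrite mxE; rewrite mxE.
Qed.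

Lemma is_derive_unique m n (A : R -> 'M[R]_(m, n)) t dA dA' :
  is_derive t (1 : R) A dA -> is_derive t (1 : R) A dA' -> dA = dA'.
Proof. by move=> [_ <-] [_ <-]. Qed.

Lemma near_is_derive m n (A B : R -> 'M[R]_(m, n)) t D :
  (\forall s \near t, A s = B s) ->
  is_derive t (1 : R) A D -> is_derive t (1 : R) B D.
Proof. exact: near_eq_is_derive. Qed.

Lemma derivable_mulmx m n p (A : R -> 'M[R]_(m, n)) (B : R -> 'M[R]_(n, p)) t :
  derivable A t (1 : R) -> derivable B t (1 : R) ->
  derivable (fun s => A s *m B s) t (1 : R).
Proof.
by move=> /derivableP hA /derivableP hB; case: (is_derive_mulmx hA hB).
Qed.

Lemma derivable_trmx m n (A : R -> 'M[R]_(m, n)) t :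
  derivable A t (1 : R) -> derivable (fun s => (A s)^T) t (1 : R).
Proof. by move=> /derivableP hA; case: (is_derive_trmx hA). Qed.

Lemma derivable_mulr (f g : R -> R) t :
  derivable f t (1 : R) -> derivable g t (1 : R) ->
  derivable (fun s => f s * g s) t (1 : R).
Proof. exact: derivableM. Qed.

Lemma derivable_prodr n (f : 'I_n -> R -> R) t :
  (forall i, derivable (f i) t (1 : R)) ->
  derivable (fun s => \prod_i f i s) t (1 : R).
Proof.
move=> h; elim: (index_enum _) => [|i r IH].
  by under eq_fun do rewrite big_nil; exact: derivable_cst.
by under eq_fun do rewrite big_cons; exact: derivable_mulr.
Qed.

Lemma derivable_sumr (I : finType) (P : pred I) (f : I -> R -> R) t :
  (forall i, P i -> derivable (f i) t (1 : R)) ->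
  derivable (fun s => \sum_(i | P i) f i s) t (1 : R).
Proof.
move=> h; elim: (index_enum _) => [|i r IH].
  by under eq_fun do rewrite big_nil; exact: derivable_cst.
under eq_fun do rewrite big_cons; case: ifPn => // Pi.
by apply: derivableD => //; exact: h.
Qed.

Lemma derivable_det n (A : R -> 'M[R]_n) t :
  derivable A t (1 : R) -> derivable (fun s => \det (A s)) t (1 : R).
Proof.
move=> hA; rewrite /determinant.
apply: derivable_sumr => s _; apply: derivable_mulr; first exact: derivable_cst.
by apply: derivable_prodr => i; exact: (derivable_mxP _ _ _).1 hA _ _.
Qed.

Lemma derivable_continuous (f : R -> R) t :
  derivable f t (1 : R) -> {for t, continuous f}.
Proof. by move=> /derivable1_diffP/differentiable_continuous. Qed.

(** Mean value theorem on the segment between two points of [J]. The statement is local to [J]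
    because competing solutions are controlled only there. *)
Lemma is_derive0_cst_itv (f : R -> R) (J : set R) :
  is_interval J -> (forall t, J t -> is_derive t (1 : R) f 0) ->
  forall s t, J s -> J t -> f s = f t.
Proof.
move=> itJ df s t Js Jt; wlog st : s t Js Jt / s <= t.
  by move=> W; case: (leP s t) => [|/ltW] /W ->.
have sub x : x \in `[s, t] -> J x.
  by rewrite in_itv/=; exact: itJ Js Jt _.
apply/esym/eqP; rewrite -subr_eq0.
have [x xs||c _ ->] := @MVT_segment R f (fun=> 0) s t st.
- by apply/df/sub; exact: subset_itv_oo_cc.
- apply: derivable_within_continuous => x xs.
  by case: (df x (sub _ xs)).
- by rewrite mul0r.
Qed.

Lemma is_derive0_cst_mx_itv m n (A : R -> 'M[R]_(m, n)) (J : set R) :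
  is_interval J -> (forall t, J t -> is_derive t (1 : R) A 0) ->
  forall s t, J s -> J t -> A s = A t.
Proof.
move=> itJ dA s t Js Jt; apply/matrixP => i j.
apply: (is_derive0_cst_itv (f := fun s => A s i j) itJ) => // x Jx.
by have /is_derive_mxP/(_ i j) := dA x Jx; rewrite mxE.
Qed.

End MatrixDerivatives.

(** * The matrix exponential *)

Section MatrixExponential.
Variables (R : realType) (n : nat).
Implicit Types (A B C : 'M[R]_n).

Definition mx_sum_norm A : R := \sum_i \sum_j `|A i j|.

Lemma mx_sum_norm_ge0 A : 0 <= mx_sum_norm A.
Proof. by apply: sumr_ge0 => i _; exact: sumr_ge0. Qed.

Lemma row_le_mx_sum_norm A i : \sum_j `|A i j| <= mx_sum_norm A.
Proof.
rewrite [leRHS](bigD1 i)//= lerDl; apply: sumr_ge0 => k _.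
exact: sumr_ge0.
Qed.

Lemma entry_le_mx_sum_norm A i j : `|A i j| <= mx_sum_norm A.
Proof.
apply: le_trans (row_le_mx_sum_norm A i).
by rewrite (bigD1 j)//= lerDl; exact: sumr_ge0.
Qed.

Lemma norm_expmx_mul A B k i j :
  `|(A ^+ k *m B) i j| <= mx_sum_norm A ^+ k * mx_sum_norm B.
Proof.
elim: k i => [|k IH] i; first by rewrite !expr0 mul1r mul1mx entry_le_mx_sum_norm.
rewrite exprS -mulmxE -mulmxA mxE; apply: le_trans (ler_norm_sum _ _ _) _.
apply: (@le_trans _ _ (\sum_l `|A i l| * (mx_sum_norm A ^+ k * mx_sum_norm B))).
  by apply: ler_sum => l _; rewrite normrM ler_wpM2l.
rewrite -mulr_suml exprS -mulrA ler_wpM2r ?row_le_mx_sum_norm//.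
by rewrite mulr_ge0 ?exprn_ge0 ?mx_sum_norm_ge0.
Qed.

(** Power series coefficients in t of entry (i, j) of exp(tA) B. The factor [B] makes the family
    stable under differentiation, which replaces [B] by [A *m B]. *)
Definition exp_entry A B i j k : R := (k`!%:R)^-1 * (A ^+ k *m B) i j.

(** Comparison with the real exponential series at [|x| * mx_sum_norm A]. *)
Lemma is_cvg_exp_entry A B i j x : cvgn (pseries (exp_entry A B i j) x).
Proof.
apply: normed_cvg.
apply: (@series_le_cvg _ _ (mx_sum_norm B *: exp_coeff (`|x| * mx_sum_norm A))).
- by move=> k; exact: normr_ge0.
- move=> k; rewrite mulr_ge0 ?mx_sum_norm_ge0// /exp_coeff divr_ge0//.
  by rewrite exprn_ge0// mulr_ge0// mx_sum_norm_ge0.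
- move=> k.
  rewrite [leRHS](_ : _ = mx_sum_norm B * exp_coeff (`|x| * mx_sum_norm A) k)//.
  rewrite /= /exp_entry !normrM normfV normrX /exp_coeff/= exprMn.
  rewrite [`|_%:R|]ger0_norm//.
  have -> : mx_sum_norm B * (`|x| ^+ k * mx_sum_norm A ^+ k / k`!%:R) =
      (k`!%:R)^-1 * (mx_sum_norm A ^+ k * mx_sum_norm B) * `|x| ^+ k by ring.
  by rewrite ler_wpM2r ?exprn_ge0// ler_wpM2l ?invr_ge0// norm_expmx_mul.
- by apply: is_cvg_seriesZ; exact: is_cvg_series_exp_coeff.
Qed.

Lemma exprZmx (t : R) A k : (t *: A) ^+ k = t ^+ k *: A ^+ k.
Proof.
elim: k => [|k IH]; first by rewrite !expr0 scale1r.
by rewrite !exprS -!mulmxE IH -scalemxAl -scalemxAr scalerA.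
Qed.

Lemma series_mexp_entry t A B i j k :
  (series (fun k => (k`!%:R : R)^-1 *: (t *: A) ^+ k) k *m B) i j =
  pseries (exp_entry A B i j) t k.
Proof.
rewrite /pseries /series/= mulmx_suml summxE; apply: eq_bigr => l _.
rewrite exprZmx -!scalemxAl /exp_entry; move: (A ^+ l *m B) => X.
by rewrite !mxE; ring.
Qed.

Lemma cvg_mexp A : series (fun k => (k`!%:R : R)^-1 *: A ^+ k) @ \oo --> mexp A.
Proof.
rewrite /mexp; set u := series _.
suff : cvgn u by [].
apply/cvg_ex; exists (\matrix_(i, j) limn (pseries (exp_entry A 1%:M i j) 1)).
apply/cvg_mxP => i j; rewrite mxE.
have -> : (fun k => u k i j) = pseries (exp_entry A 1%:M i j) 1.
  by apply/funext => k; rewrite -series_mexp_entry scale1r mulmx1.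
exact: is_cvg_exp_entry.
Qed.

Lemma mexp_entry t A B i j :
  (mexp (t *: A) *m B) i j = limn (pseries (exp_entry A B i j) t).
Proof.
apply/esym/cvg_lim => //.
have /cvg_mxP/(_ i j) := cvg_mulmxr (B := B) (@cvg_mexp (t *: A)).
by under eq_fun do rewrite series_mexp_entry.
Qed.

Lemma is_derive_mexp t A :
  is_derive t (1 : R) (fun s => mexp (s *: A)) (mexp (t *: A) *m A).
Proof.
have diffs B i j : pseries_diffs (exp_entry A B i j) = exp_entry A (A *m B) i j.
  apply/funext => k; rewrite /pseries_diffs /exp_entry factS natrM invfM.
  by rewrite mulrA mulVKf// exprSr -mulmxE mulmxA.
apply/is_derive_mxP => i j; rewrite mexp_entry.
have -> : (fun s => mexp (s *: A) i j) =
    (fun s => limn (pseries (exp_entry A 1%:M i j) s)).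
  by apply/funext => s; rewrite -mexp_entry mulmx1.
(* Termwise differentiation needs convergence at a point farther from 0 than t; [|t| + 1] is one. *)
have := @pseries_snd_diffs R (exp_entry A 1%:M i j) (`|t| + 1) t.
rewrite !diffs !mulmx1; apply; try exact: is_cvg_exp_entry.
by rewrite [ltRHS]ger0_norm ?ltrDl// addr_ge0.
Qed.

Lemma mexp_comm A t : A *m mexp (t *: A) = mexp (t *: A) *m A.
Proof.
have l := cvg_mulmxl (B := A) (@cvg_mexp (t *: A)).
have r := cvg_mulmxr (B := A) (@cvg_mexp (t *: A)).
rewrite -(cvg_lim (@norm_hausdorff _ _) l) -(cvg_lim (@norm_hausdorff _ _) r).
congr (limn _); apply/funext => k.
rewrite /series/= mulmx_suml mulmx_sumr; apply: eq_bigr => i _.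
by rewrite exprZmx -!scalemxAl -!scalemxAr !mulmxE -exprSr exprS.
Qed.

Lemma mexp0 : mexp (0 : 'M[R]_n) = 1%:M.
Proof.
apply/cvg_lim; first exact: norm_hausdorff.
rewrite -cvg_shiftS; apply: cvg_near_cst.
near=> k; rewrite /series/= big_nat_recl//= expr0 invr1 scale1r big1 ?addr0//.
by move=> i _; rewrite exprS mul0r scaler0.
Unshelve. all: by end_near. Qed.

Lemma is_derive_mexpN t A :
  is_derive t (1 : R) (fun s => mexp (- s *: A)) (- (mexp (- t *: A) *m A)).
Proof.
have := is_derive_mexp t (- A); rewrite mulmxN scalerN -scaleNr.
by under eq_fun do rewrite scalerN -scaleNr.
Qed.

(** The product has zero derivative, as [A] commutes with its exponential, and equals 1 at time
    0. *)
Lemma mexpNK t A : mexp (- t *: A) *m mexp (t *: A) = 1%:M.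
Proof.
have -> : mexp (- t *: A) *m mexp (t *: A) = mexp (- 0 *: A) *m mexp (0 *: A).
  apply: (@is_derive0_cst_mx_itv R _ _ (fun s => mexp (- s *: A) *m mexp (s *: A))
    setT) => // s _.
  apply: is_derive_eq (is_derive_mulmx (is_derive_mexpN s A) (is_derive_mexp s A)) _.
  by rewrite mulNmx -!mulmxA mexp_comm addNr.
by rewrite oppr0 scale0r mexp0 mulmx1.
Qed.

Lemma mexpKN t A : mexp (t *: A) *m mexp (- t *: A) = 1%:M.
Proof. by apply: mulmx1C; exact: mexpNK. Qed.

Lemma lower_mexp A : lower A -> lower (mexp A).
Proof.
move=> lA; apply/lowerP => i j ij.
have lX k : lower (A ^+ k).
  by elim: k => [|k IH]; [exact: lower1|rewrite exprS -mulmxE; exact: lower_mul].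
have /cvg_mxP/(_ i j) := @cvg_mexp A.
move/(cvg_lim (@Rhausdorff R)) => <-.
under eq_fun => k.
  rewrite /series/= summxE big1; last by move=> l _; rewrite mxE (lowerP _).1 ?mulr0.
  over.
exact: lim_cst.
Qed.

End MatrixExponential.

(** * Differentiability of the factors *)

Section DerivableFactorizations.
Variables (R : realType) (n : nat).
Implicit Types (A L U Q S : R -> 'M[R]_n).

Lemma derivable_entry m p (A : R -> 'M[R]_(m, p)) t :
  derivable A t (1 : R) <-> forall i j, derivable (fun s => A s i j) t (1 : R).
Proof.
split=> [h i j|h]; first exact: (derivable_mxP _ _ _).1 h i j.
exact: (derivable_mxP _ _ _).2.
Qed.

Lemma derivable_near m p (A B : R -> 'M[R]_(m, p)) t :
  (\forall s \near t, A s = B s) ->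
  derivable A t (1 : R) -> derivable B t (1 : R).
Proof. exact: near_eq_derivable. Qed.

Lemma derivable_nearr (f g : R -> R) t :
  (\forall s \near t, f s = g s) ->
  derivable f t (1 : R) -> derivable g t (1 : R).
Proof. exact: near_eq_derivable. Qed.

Lemma near_cst_is_derive (f : R -> R) (c : R) t D :
  (\forall s \near t, f s = c) -> is_derive t (1 : R) f D -> D = 0.
Proof.
move=> fc [_ <-]; rewrite (near_eq_derive (g := cst c))//.
exact: derive_cst.
Qed.

Lemma derivable_mulV (f g : R -> R) t : g t != 0 ->
  derivable f t (1 : R) -> derivable g t (1 : R) ->
  derivable (fun s => f s / g s) t (1 : R).
Proof. by move=> gt hf hg; apply: derivable_mulr => //; exact: derivableV. Qed.

Lemma derivable_subr (f g : R -> R) t :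
  derivable f t (1 : R) -> derivable g t (1 : R) ->
  derivable (fun s => f s - g s) t (1 : R).
Proof. exact: derivableB. Qed.

(** Cramer's rule: cofactors divided by the determinant. Invertibility is asked near [t] because
    [invmx] follows this formula only on [unitmx]. *)
Lemma derivable_invmx A t : (\forall s \near t, A s \in unitmx) ->
  derivable A t (1 : R) -> derivable (fun s => invmx (A s)) t (1 : R).
Proof.
move=> uA dA; apply/derivable_entry => i j.
apply: (@derivable_nearr (fun s => (cofactor (A s) j i) / \det (A s))).
  near=> s; have uAs : A s \in unitmx by near: s.
  by rewrite /invmx uAs !mxE mulrC.
apply: derivable_mulV.
- by have := nbhs_singleton uA; rewrite unitmxE unitfE.
- apply: derivable_mulr; first exact: derivable_cst.
  apply: derivable_det; apply/derivable_entry => a b.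
  under eq_fun do rewrite !mxE.
  by have /derivable_entry := dA; apply.
- exact: derivable_det.
Unshelve. all: by end_near. Qed.

(* Induction on the smaller index, following the recursive formulas for the
   entries of the factors. *)
Lemma derivable_LU A L U t : derivable A t (1 : R) ->
  (\forall s \near t, [/\ unit_lower (L s), upper_pos (U s) & A s = L s *m U s]) ->
  derivable L t (1 : R) /\ derivable U t (1 : R).
Proof.
move=> /derivable_entry dA LU.
suff h m (i j : 'I_n) : minn i j = m ->
    derivable (fun s => L s i j) t (1 : R) /\ derivable (fun s => U s i j) t (1 : R).
  by split; apply/derivable_entry => i j; have [] := h _ i j erefl.
elim/ltn_ind: m i j => m IH.
(* The remainder of [A s i j] after removing the products whose factors are covered by the induction
   hypothesis. *)
have dS i j : derivable (fun s => A s i j -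
    \sum_(k < n | (k < m)%N && (k < i)%N && (k < j)%N) L s i k * U s k j) t (1 : R).
  apply: derivable_subr => //; apply: derivable_sumr => k /andP[/andP[km ki] kj].
  apply: derivable_mulr.
    by have [] := IH k km i k; rewrite ?(minn_idPr _)// ltnW.
  by have [] := IH k km k j; rewrite ?(minn_idPl _)// ltnW.
(* On or above the diagonal the remainder is [U s i j] itself, since [L] has unit diagonal. *)
have dU (i j : 'I_n) : minn i j = m -> derivable (fun s => U s i j) t (1 : R).
  move=> mE; have [ij|ji] := leqP i j; last first.
    apply: (@derivable_nearr (cst 0)); last exact: derivable_cst.
    by apply: filterS LU => s [_ [uU _] _]; rewrite (upperP _).1.
  apply: derivable_nearr (dS i j); apply: filterS LU => s [[lL dL] [uU _] ->].
  have {}mE : m = i by rewrite -mE (minn_idPl _).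
  rewrite mxE (bigID (fun k : 'I_n => (k < i)%N))/=.
  rewrite [X in _ + X - _](bigD1 i) ?ltnn//= [X in _ + (_ + X) - _]big1 ?addr0.
    rewrite dL mul1r addrAC [X in X + _](_ : _ = 0) ?add0r//.
    apply/eqP; rewrite subr_eq0; apply/eqP; apply: eq_bigl => k.
    rewrite mE; case ki: (k < i)%N => //=.
    by rewrite (leq_trans ki).
  move=> k /andP[]; rewrite -leqNgt leq_eqVlt => /orP[/eqP/val_inj ->|ik _].
    by rewrite eqxx.
  by rewrite (lowerP (L s)).1 ?mul0r.
move=> i j mE; split; last exact: dU.
have [ij|ji|/val_inj ij] := ltngtP i j.
- apply: (@derivable_nearr (cst 0)); last exact: derivable_cst.
  by apply: filterS LU => s [[lL _] _ _]; rewrite (lowerP _).1.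
- have {}mE : m = j by rewrite -mE (minn_idPr _)// ltnW.
  (* Below the diagonal the remainder is [L s i j * U s j j]; the pivot has the same smaller index
     [m], hence the treatment of [U] first. *)
  have dUj : derivable (fun s => U s j j) t (1 : R) by apply: dU; rewrite minnn.
  apply: derivable_nearr (derivable_mulV _ (dS i j) dUj); last first.
    by have [_ [_ pU] _] := nbhs_singleton LU; rewrite gt_eqF.
  apply: filterS LU => s [[lL dL] [uU pU] ->].
  rewrite mxE (bigID (fun k : 'I_n => (k < j)%N))/=.
  rewrite [X in _ + X - _](bigD1 j) ?ltnn//= [X in _ + (_ + X) - _]big1 ?addr0.
    rewrite addrAC [X in X + _](_ : _ = 0) ?add0r ?mulfK ?gt_eqF//.
    apply/eqP; rewrite subr_eq0; apply/eqP; apply: eq_bigl => k.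
    rewrite mE; case kj: (k < j)%N => //=.
    by rewrite (ltn_trans kj).
  move=> k /andP[]; rewrite -leqNgt leq_eqVlt => /orP[/eqP/val_inj ->|jk _].
    by rewrite eqxx.
  by rewrite (upperP (U s)).1 ?mulr0.
- apply: (@derivable_nearr (cst 1)); last exact: derivable_cst.
  by apply: filterS LU => s [[_ dL] _ _]; rewrite ij dL.
Qed.

(* [A^T *m A = S^T *m S] is, up to a diagonal factor, an LU factorization. *)
Lemma derivable_QR A Q S t : derivable A t (1 : R) ->
  (\forall s \near t,
    [/\ (Q s)^T *m Q s = 1%:M, upper_pos (S s) & A s = Q s *m S s]) ->
  derivable Q t (1 : R) /\ derivable S t (1 : R).
Proof.
move=> dA QS.
pose U s := diag_mx (\row_i S s i i) *m S s.
pose L s := (S s)^T *m diag_mx (\row_i (S s i i)^-1).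
have UE s i j : U s i j = S s i i * S s i j by rewrite /U mul_diag_mx !mxE.
have [_ dU] : derivable L t (1 : R) /\ derivable U t (1 : R).
  apply: (@derivable_LU (fun s => (A s)^T *m A s)).
    have h := derivable_mulmx (derivable_trmx dA) dA; exact: h.
  apply: filterS QS => s [oQ [uS pS] ->]; split.
  - split=> [|i]; last by rewrite /L mul_mx_diag !mxE mulfV// gt_eqF.
    apply: lower_mul; [exact: uS|exact: diag_mx_is_trig].
  - split=> [|i]; last by rewrite UE mulr_gt0.
    by apply: upper_mul => //; rewrite /upper tr_diag_mx diag_mx_is_trig.
  - rewrite trmx_mul -mulmxA (mulmxA (Q s)^T) oQ mul1mx /L /U -mulmxA.
    congr (_ *m _); rewrite mulmxA mulmx_diag -[LHS]mul1mx; congr (_ *m _).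
    rewrite -diag_const_mx; congr diag_mx; apply/rowP => i.
    by rewrite !mxE mulVf// gt_eqF.
have dS : derivable S t (1 : R).
  apply/derivable_entry => i j.
  have /derivable_entry dUij := dU.
  (* [U s i i] is the square of the positive number [S s i i]. *)
  apply: (@derivable_nearr (fun s => U s i j / Num.sqrt (U s i i))).
    apply: filterS QS => s [_ [_ pS] _].
    rewrite !UE -expr2 sqrtr_sqr gtr0_norm// mulrC mulKf// gt_eqF//.
  have [_ [_ pS] _] := nbhs_singleton QS.
  have pU : 0 < U t i i by rewrite UE mulr_gt0.
  apply: derivable_mulV => //; first by rewrite gt_eqF// sqrtr_gt0.
  have := is_derive1_comp (is_derive1_sqrt pU) (derivableP (dUij i i)).
  by case.
split; last exact: dS.
apply: (@derivable_near _ _ (fun s => A s *m invmx (S s))).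
  by apply: filterS QS => s [_ hS ->]; rewrite mulmxK// upper_pos_unit.
have uS : \forall s \near t, S s \in unitmx.
  by apply: filterS QS => s [_ hS _]; exact: upper_pos_unit.
have h := derivable_mulmx dA (derivable_invmx uS dS); exact: h.
Qed.

End DerivableFactorizations.

(** * Linearizing coordinates *)

Section LinearizingData.
Variables (R : realType) (n : nat) (lam : 'rV[R]_n) (pi : 'S_n).
Hypothesis lam_decr : forall i j : 'I_n, (i < j)%N -> lam 0 j < lam 0 i.
Implicit Types (M Q Y L U B X T : 'M[R]_n).

Let D := Dpi lam pi.

Lemma lam_inj i j : lam 0 i = lam 0 j -> i = j.
Proof.
move=> e; apply/val_inj; case: (ltngtP i j) => // /lam_decr; rewrite e ltxx//.
Qed.

Lemma Dpi_diag i : D i i = lam 0 (pi i).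
Proof. by rewrite /D DpiE !mxE eqxx mulr1n. Qed.

Lemma Dpi_inj i j : D i i = D j j -> i = j.
Proof. by rewrite !Dpi_diag => /lam_inj/perm_inj. Qed.

Lemma Dpi_lower : lower D.
Proof. by rewrite /D DpiE; exact: diag_mx_is_trig. Qed.

Lemma lower_addD Y : strictly_lower Y -> lower (Y + D).
Proof. by move=> hY; apply: lowerD Dpi_lower; exact: strictly_lower_lower. Qed.

Lemma diag_addD Y i : strictly_lower Y -> (Y + D) i i = D i i.
Proof. by move=> hY; rewrite mxE hY// add0r. Qed.

(** Both diagonals are that of [D], whose entries are distinct, so the coefficients divided by in
    the triangular recursion are nonzero. *)
Lemma sylvester_Dpi T T' S : lower T -> lower T' ->
  (forall i, T i i = D i i) -> (forall i, T' i i = D i i) ->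
  (forall i j : 'I_n, (i < j)%N -> (S *m T - T' *m S) i j = 0) -> lower S.
Proof.
move=> lT lT' dT dT' E0; apply: (sylvester_lower lT lT') => // i j ij.
by rewrite dT dT'; apply/eqP => /Dpi_inj ji; rewrite ji ltnn in ij.
Qed.

Lemma strictly_lower_conj L Y : unit_lower L -> strictly_lower Y ->
  strictly_lower (invmx L *m (Y + D) *m L - D).
Proof.
move=> hL hY; have [lL dL] := hL; have [lLi dLi] := unit_lower_inv hL.
have lYD := lower_addD hY; have l1 := lower_mul lLi lYD.
apply: strictly_lower_subP; first exact: lower_mul l1 lL.
  exact: Dpi_lower.
by move=> i; rewrite lower_mul_diag// lower_mul_diag// dL dLi mulr1 mul1r diag_addD.
Qed.

(** Positivity of the leading minors of [Q] is a consequence of its LU factorization, and [Z] is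
    forced by [Y] and [L]. *)
Lemma is_lin_data_intro Q Y L U : Q^T *m Q = 1%:M -> strictly_lower Y ->
  unit_lower L -> upper_pos U -> Q = L *m U ->
  is_lin_data lam pi (Q^T *m (Y + D) *m Q)
    (LinData D Q Y L U (invmx L *m (Y + D) *m L - D)).
Proof.
move=> oQ hY hL hU QE; split=> //.
- split=> //; split=> //; rewrite QE.
  apply: pos_leading_minors_lower_mul; first by case: hL.
    by case: hL => _ dL i; rewrite dL.
  exact: pos_leading_minors_upper.
- by split; [exact: strictly_lower_conj|rewrite subrK].
Qed.

(** The QR factorization of [X^T] gives [X = B *m Q] with [B] lower triangular of positive diagonal.
    Then [M] is the conjugate by [Q] of [invmx B *m D *m B], which is lower triangular with the
    diagonal of [D]. *)
Lemma UGL_lin_data M : UGL lam pi M -> exists d, is_lin_data lam pi M d.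
Proof.
move=> [X [uX pX] <-]; rewrite -/D.
have [|Qt [S [oQt hS XE]]] := @QR_exists _ _ X^T; first by rewrite unitmx_tr.
pose Q := Qt^T; have oQ : Q^T *m Q = 1%:M by rewrite trmxK; exact: mulmx1C.
have oQ' : Q *m Q^T = 1%:M by exact: mulmx1C.
pose B := S^T; have {}XE : X = B *m Q by rewrite -[X]trmxK XE trmx_mul.
have lB : lower B by rewrite /lower; case: hS.
have pB i : 0 < B i i by case: hS => _ h; rewrite mxE.
have nB i : B i i != 0 by rewrite gt_eqF.
have uB : B \in unitmx by exact: lower_unit.
have pQ : pos_leading_minors Q.
  move=> k; have := pX k; rewrite XE leading_minor_lower_mul// pmulr_rgt0//.
  exact: prodr_gt0.
have [L [U [hL hU QE]]] := LU_exists pQ.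
have XiE : invmx X = Q^T *m invmx B.
  have e : Q^T *m invmx B *m X = 1%:M by rewrite XE mulmxA mulmxKV.
  by rewrite -[RHS](mulmxK uX) e mul1mx.
pose Y := invmx B *m D *m B - D.
have hY : strictly_lower Y.
  have lBi := lower_inv lB nB; have l1 := lower_mul lBi Dpi_lower.
  apply: strictly_lower_subP; first exact: lower_mul l1 lB.
    exact: Dpi_lower.
  move=> i; rewrite lower_mul_diag// lower_mul_diag//; last exact: Dpi_lower.
  by rewrite lower_inv_diag// mulrAC mulVf// mul1r.
exists (LinData D Q Y L U (invmx L *m (Y + D) *m L - D)).
have -> : invmx X *m D *m X = Q^T *m (Y + D) *m Q.
  by rewrite XiE XE subrK !mulmxA.
exact: is_lin_data_intro.
Qed.

(** [W = Q' *m Q^T] intertwines [Y + D] and [Y' + D], hence is lower triangular; being orthogonal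
    with positive diagonal, it is the identity. *)
Lemma lin_data_unique M d d' :
  is_lin_data lam pi M d -> is_lin_data lam pi M d' -> d = d'.
Proof.
case: d => D1 Q Y L U Z [-> [[oQ _] hY] ME [hL hU QE] [_ ZE]].
case: d' => D2 Q' Y' L' U' Z' [-> [[oQ' _] hY'] ME' [hL' hU' QE'] [_ ZE']].
rewrite -/D in ME ME' ZE ZE' *.
have oQ2 : Q *m Q^T = 1%:M by exact: mulmx1C.
have oQ2' : Q' *m Q'^T = 1%:M by exact: mulmx1C.
have uL := unit_lower_unit hL; have uL' := unit_lower_unit hL'.
have uU := upper_pos_unit hU.
pose W := Q' *m Q^T.
have lW : lower W.
  apply: (@sylvester_Dpi (Y + D) (Y' + D)).
  - exact: lower_addD.
  - exact: lower_addD.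
  - by move=> i; exact: diag_addD.
  - by move=> i; exact: diag_addD.
  move=> i j _; suff -> : W *m (Y + D) = (Y' + D) *m W by rewrite subrr mxE.
  have e1 : Q^T *m (Y + D) = M *m Q^T by rewrite ME -mulmxA oQ2 mulmx1.
  have e2 : (Y' + D) *m Q' = Q' *m M by rewrite ME' !mulmxA oQ2' mul1mx.
  by rewrite /W -mulmxA e1 !mulmxA e2.
pose K := U' *m invmx U.
have hK : upper_pos K := upper_pos_mul hU' (upper_pos_inv hU).
(* The LU factorizations enter here: [K] is also lower triangular, so [W] has the positive diagonal
   of [K]. *)
have WE : W = L' *m K *m invmx L.
  have QV : Q *m (invmx U *m invmx L) = 1%:M.
    by rewrite QE mulmxA mulmxK// mulmxV.
  have QtE : Q^T = invmx U *m invmx L by rewrite -[LHS]mulmx1 -QV mulmxA oQ mul1mx.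
  by rewrite /W QE' QtE /K !mulmxA.
have hLi := unit_lower_inv hL; have hLi' := unit_lower_inv hL'.
have KE : K = invmx L' *m W *m L.
  by rewrite WE -mulmxA mulmxKV// mulmxA mulVmx// mul1mx.
have lK : lower K.
  rewrite KE; apply: lower_mul; last by case: hL.
  by apply: lower_mul => //; case: hLi'.
have pW i : 0 < W i i.
  have lL'K : lower (L' *m K) by apply: lower_mul => //; case: hL'.
  rewrite WE lower_mul_diag//; last by case: hLi.
  rewrite lower_mul_diag//; last by case: hL'.
  case: hLi => _ ->; case: hL' => _ ->; rewrite mul1r mulr1.
  by case: hK.
have WtE : W^T = 1%:M.
  apply: upper_orthogonal; first by split=> [|i]; [exact: lower_tr|rewrite mxE].
  by rewrite trmxK /W trmx_mul trmxK mulmxA -(mulmxA Q') oQ mulmx1.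
have QQ : Q' = Q.
  have W1 : W = 1%:M by rewrite -[W]trmxK WtE trmx1.
  by rewrite -[LHS]mulmx1 -oQ mulmxA -/W W1 mul1mx.
have TT : Y' + D = Y + D.
  have e X : X = Q *m (Q^T *m X *m Q) *m Q^T.
    by rewrite !mulmxA oQ2 mul1mx -mulmxA oQ2 mulmx1.
  by move: ME'; rewrite QQ => ME'; rewrite [LHS]e [RHS]e -ME -ME'.
have YY : Y' = Y by apply: (addIr D).
have [LL UU] : L = L' /\ U = U' by apply: LU_unique => //; rewrite -QE -QE' QQ.
have ZZ : Z' = Z by apply: (addIr D); rewrite ZE ZE' TT LL.
by rewrite QQ YY ZZ LL UU.
Qed.

Lemma lin_data_of_eq M d : is_lin_data lam pi M d -> lin_data_of lam pi M = d.
Proof.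
move=> h; apply: get_unique => // d' h'; exact: lin_data_unique h' h.
Qed.

Lemma lin_data_ofP M : UGL lam pi M -> is_lin_data lam pi M (lin_data_of lam pi M).
Proof. by move=> /UGL_lin_data[d h]; rewrite (lin_data_of_eq h). Qed.

(** Writing [X = B *m Q], the factor [B] conjugates [Y + D] to [D] and is lower triangular with
    positive diagonal; hence [B *m Q'] is a conjugating matrix in [GLpos] for [M']. *)
Lemma UGL_same_Y M M' d d' : UGL lam pi M ->
  is_lin_data lam pi M d -> is_lin_data lam pi M' d' -> lin_Y d = lin_Y d' ->
  UGL lam pi M'.
Proof.
case: d => D1 Q Y L U Z; case: d' => D2 Q' Y' L' U' Z' [X [uX pX] XM].
move=> [-> [[oQ pQ] hY] ME _ _] [-> [[oQ' pQ'] _] ME' _ _] /= YY.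
rewrite -{Y'}YY -/D in XM ME ME' *.
have oQ2 : Q *m Q^T = 1%:M by exact: mulmx1C.
have oQ2' : Q' *m Q'^T = 1%:M by exact: mulmx1C.
have [B BE XE] : exists2 B, B = X *m Q^T & X = B *m Q.
  by exists (X *m Q^T) => //; rewrite -mulmxA oQ mulmx1.
have BD : B *m (Y + D) = D *m B.
  have e1 : Q^T *m (Y + D) = M *m Q^T by rewrite ME -mulmxA oQ2 mulmx1.
  by rewrite BE -mulmxA e1 -XM !mulmxA mulmxV// mul1mx.
have lB : lower B.
  apply: (@sylvester_Dpi (Y + D) D).
  - exact: lower_addD.
  - exact: Dpi_lower.
  - by move=> i; exact: diag_addD.
  - by [].
  by move=> i j _; rewrite BD subrr mxE.
have pB : forall i, 0 < B i i.
  by apply: (pos_diag_of_minors lB pQ); rewrite -XE.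
have uB : B \in unitmx by apply: lower_unit => // i; rewrite gt_eqF.
have uX' : B *m Q' \in unitmx.
  by rewrite unitmx_mul uB; case: (mulmx1_unit oQ').
exists (B *m Q'); first by split=> //; exact: pos_leading_minors_lower_mul.
rewrite -/D ME' -[RHS](mulKmx uX') -mulmxA; congr (_ *m _).
by rewrite !mulmxA -(mulmxA B) oQ2' mulmx1 BD.
Qed.

End LinearizingData.

(** * The flow of the factors *)

Section Derivatives.
Variables (R : realType) (n : nat).
Implicit Types (A L U Q S : R -> 'M[R]_n) (B C D T : 'M[R]_n).

Lemma near_cst_is_derive_mx A B t dA :
  (\forall s \near t, A s = B) -> is_derive t (1 : R) A dA -> dA = 0.
Proof.
move=> AB /is_derive_mxP hA; apply/matrixP => i j; rewrite mxE.
apply: near_cst_is_derive (hA i j) => //.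
by apply: filterS AB => s ->.
Qed.

Lemma upper_is_derive S t dS :
  (\forall s \near t, upper (S s)) -> is_derive t (1 : R) S dS -> upper dS.
Proof.
move=> uS /is_derive_mxP hS; apply/upperP => i j ji.
apply: near_cst_is_derive (hS i j) => //.
by apply: filterS uS => s /upperP; apply.
Qed.

Lemma orthogonal_is_derive Q t dQ :
  (\forall s \near t, (Q s)^T *m Q s = 1%:M) -> is_derive t (1 : R) Q dQ ->
  dQ^T *m Q t + (Q t)^T *m dQ = 0.
Proof.
move=> oQ hQ; have h := is_derive_mulmx (is_derive_trmx hQ) hQ.
exact: near_cst_is_derive_mx oQ h.
Qed.

(** The Lax form of the equation: for skew-symmetric [B], differentiating the two outer factors
    produces the two terms of the bracket. *)
Lemma is_derive_conj Q T (t : R) B :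
  Defs.skew B -> is_derive t (1 : R) Q (Q t *m B) ->
  is_derive t (1 : R) (fun s => (Q s)^T *m T *m Q s)
    (bracket ((Q t)^T *m T *m Q t) B).
Proof.
move=> skB hQ.
have h1 := is_derive_mulmx (is_derive_trmx hQ) (is_derive_cst T t 1).
apply: is_derive_eq (is_derive_mulmx h1 hQ) _.
rewrite mulmx0 addr0 trmx_mul skB /bracket !mulNmx !mulmxA addrC//.
Qed.

(* The flow of [L] becomes that of [Q] in the factorization [L = Q *m S]: the
   derivative of [S] only contributes upper triangular terms. *)
Lemma is_derive_QR C L Q S t :
  (\forall s \near t,
    [/\ (Q s)^T *m Q s = 1%:M, upper_pos (S s) & L s = Q s *m S s]) ->
  is_derive t (1 : R) L (C *m L t - L t *m diag_part C) ->
  is_derive t (1 : R) Q (Q t *m proj_skew ((Q t)^T *m C *m Q t)).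
Proof.
move=> QS hL; have [oQ hS LE] := nbhs_singleton QS.
have dL : derivable L t (1 : R) by case: hL.
have [/derivableP hQ /derivableP hdS] := derivable_QR dL QS.
set dQ := 'D_1 Q t in hQ; set dS := 'D_1 S t in hdS.
have oQ2 : Q t *m (Q t)^T = 1%:M by exact: mulmx1C.
have skK : dQ^T *m Q t + (Q t)^T *m dQ = 0.
  by apply: orthogonal_is_derive hQ; apply: filterS QS => s [].
have udS : upper dS by apply: upper_is_derive hdS; apply: filterS QS => s [_ []].
have e : dQ *m S t + Q t *m dS = C *m L t - L t *m diag_part C.
  apply: is_derive_unique hL; apply: near_is_derive (is_derive_mulmx hQ hdS).
  by apply: filterS QS => s [].
have uS := upper_pos_unit hS.
suff <- : (Q t)^T *m dQ = proj_skew ((Q t)^T *m C *m Q t).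
  by rewrite mulmxA oQ2 mul1mx.
apply: proj_skew_uniq.
  by rewrite /Defs.skew trmx_mul trmxK; apply/eqP; rewrite -addr_eq0 skK.
(* Equation [e] multiplied by [Q^T] on the left and by the inverse of [S] on the right; the result
   is visibly upper triangular. *)
have -> : (Q t)^T *m C *m Q t - (Q t)^T *m dQ =
    (dS + S t *m diag_part C) *m invmx (S t).
  apply: (canRL (mulmxK uS)); rewrite mulmxBl.
  have /(congr1 (mulmx (Q t)^T)) := e; rewrite LE !mulmxDr mulmxN !mulmxA oQ !mul1mx.
  move=> /esym/eqP; rewrite subr_eq => /eqP ->.
  by rewrite addrAC [X in X + _]addrAC subrr add0r.
case: hS (upper_pos_inv hS) => uuS _ [uiS _].
apply: upper_mul => //; rewrite /upper linearD/=; apply: lowerD => //.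
by apply: upper_mul => //; rewrite /upper tr_diag_mx diag_mx_is_trig.
Qed.

End Derivatives.

(** * The explicit lower unitriangular flow *)

Section Existence.
Variables (R : realType) (n : nat) (C L0 : 'M[R]_n).
Hypotheses (C_lower : lower C) (L0_unit : unit_lower L0).

Lemma diag_part_diag (A : 'M[R]_n) i : diag_part A i i = A i i.
Proof. by rewrite !mxE eqxx mulr1n. Qed.

Definition lower_flow t := mexp (t *: C) *m L0 *m mexp (- t *: diag_part C).

Lemma lower_diag_part : lower (diag_part C).
Proof. exact: diag_mx_is_trig. Qed.

Lemma lower_flow0 : lower_flow 0 = L0.
Proof. by rewrite /lower_flow oppr0 !scale0r !mexp0 mulmx1 mul1mx. Qed.

Lemma is_derive_lower_flow t :
  is_derive t (1 : R) lower_flow (C *m lower_flow t - lower_flow t *m diag_part C).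
Proof.
have h1 := is_derive_mulmx (is_derive_mexp t C) (is_derive_cst L0 t 1).
apply: is_derive_eq (is_derive_mulmx h1 (is_derive_mexpN t (diag_part C))) _.
by rewrite mulmx0 addr0 -mexp_comm mulmxN /lower_flow !mulmxA.
Qed.

Lemma lowerZ (a : R) (A : 'M[R]_n) : lower A -> lower (a *: A).
Proof. by move=> /lowerP h; apply/lowerP => i j ij; rewrite mxE h ?mulr0. Qed.

(** The diagonal entries of [C L] and [L diag C] coincide for lower triangular [L], so the diagonal
    of the flow is constant. *)
Lemma unit_lower_flow t : unit_lower (lower_flow t).
Proof.
have lF s : lower (lower_flow s).
  apply: lower_mul; last by apply: lower_mexp; apply: lowerZ lower_diag_part.
  by apply: lower_mul; [apply: lower_mexp; exact: lowerZ|case: L0_unit].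
split=> // i; have [_ dL0] := L0_unit; rewrite -(dL0 i) -lower_flow0.
apply: (is_derive0_cst_itv (f := fun s => lower_flow s i i) (J := setT)) => // s _.
have /is_derive_mxP/(_ i i) h := is_derive_lower_flow s.
apply: is_derive_eq h _; rewrite mxE [X in _ + X]mxE.
rewrite (lower_mul_diag i C_lower (lF s)) (lower_mul_diag i (lF s) lower_diag_part).
by rewrite diag_part_diag mulrC subrr.
Qed.

End Existence.

(** * Regularity of the orthogonal factor *)

Section Flag.
Variables (R : realType) (n : nat) (c : nat -> R).
Implicit Types (X T Q : 'M[R]_n).

(* For [T] lower triangular with diagonal [c], right multiplication by
   [flag_poly k T] maps row vectors to those supported on the first [n - k]
   coordinates. *)
Fixpoint flag_poly k X : 'M[R]_n :=
  if k is k'.+1 then flag_poly k' X *m (X - (c (n - k))%:M) else 1%:M.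

Lemma flag_poly_conj k X T Q :
  Q *m X = T *m Q -> Q *m flag_poly k X = flag_poly k T *m Q.
Proof.
move=> e; elim: k => [|k IH] /=; first by rewrite mulmx1 mul1mx.
rewrite mulmxA IH -!mulmxA mulmxBr mulmxBl e; congr (_ *m (_ - _)).
by rewrite scalar_mxC.
Qed.

Lemma lower_sub_scalar T a : lower T -> lower (T - a%:M).
Proof. by move=> lT; apply: lowerD => //; apply: lowerN; exact: scalar_mx_is_trig. Qed.

Lemma lower_flag_poly k T : lower T -> lower (flag_poly k T).
Proof.
move=> lT; elim: k => [|k IH] /=; first exact: lower1.
by apply: lower_mul => //; exact: lower_sub_scalar.
Qed.

(** Each new factor kills one more column from the right: in column n - k - 1 the shifted matrix has
    zero diagonal entry, and the entries below meet columns already killed. *)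
Lemma flag_poly_eq0 k T : lower T -> (forall i, T i i = c i) -> (k <= n)%N ->
  forall a b : 'I_n, (n <= b + k)%N -> flag_poly k T a b = 0.
Proof.
move=> lT dT; elim: k => [|k IH] kn a b nb /=.
  by have := ltn_ord b; rewrite addn0 in nb; rewrite ltnNge nb.
rewrite mxE big1// => l _; have [nl|ln] := leqP n (l + k).
  by rewrite IH ?mul0r// ltnW.
have lb : (l <= b)%N by rewrite -(leq_add2r k.+1) (leq_trans _ nb)// addnS.
move: lb; rewrite leq_eqVlt => /orP[/eqP/val_inj lb|lb]; last first.
  by rewrite ((lowerP _).1 (lower_sub_scalar _ lT)) ?mulr0.
have bE : (n - k.+1)%N = b.
  apply/eqP; rewrite eqn_leq leq_subLR addnC nb leq_subRL// -lb addnC addnS.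
  exact: ln.
by rewrite lb !mxE eqxx mulr1n dT bE subrr mulr0.
Qed.

Lemma flag_poly_diag k T i : lower T ->
  flag_poly k T i i = \prod_(j < k) (T i i - c (n - j.+1)).
Proof.
move=> lT; elim: k => [|k IH]; first by rewrite big_ord0 mxE eqxx.
rewrite big_ord_recr/= lower_mul_diag; last exact: lower_sub_scalar.
  by rewrite IH !mxE eqxx mulr1n.
exact: lower_flag_poly.
Qed.

Lemma derivable_flag_poly k (N : R -> 'M[R]_n) t : derivable N t (1 : R) ->
  derivable (fun s => flag_poly k (N s)) t (1 : R).
Proof.
move=> dN; elim: k => [|k IH] /=; first exact: derivable_cst.
have dNc : derivable (fun s => N s - (c (n - k.+1))%:M) t (1 : R).
  have h := derivableB dN (derivable_cst ((c (n - k.+1))%:M : 'M[R]_n) t 1).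
  exact: h.
have h := derivable_mulmx IH dNc; exact: h.
Qed.

End Flag.

Section Regularity.
Variables (R : realType) (n : nat) (lam : 'rV[R]_n) (pi : 'S_n).
Hypothesis lam_decr : forall i j : 'I_n, (i < j)%N -> lam 0 j < lam 0 i.

Let D := Dpi lam pi.
Let data M := lin_data_of lam pi M.

(* The rows of [W s] are, up to constants, those of [Q0] times polynomials in
   [N s]; [W s = B s *m Q s] with [B s] lower triangular, so the orthogonal
   factor of [(W s)^T] is [(Q s)^T] as long as the diagonal of [B s] is
   positive. *)
Lemma derivable_lin_Q (N : R -> 'M[R]_n) t : derivable N t (1 : R) ->
  (\forall s \near t, UGL lam pi (N s)) ->
  derivable (fun s => lin_Q (data (N s))) t (1 : R).
Proof.
move=> dN UN.
pose c m := if insub m is Some i then D i i else 0.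
have cE (i : 'I_n) : c i = D i i by rewrite /c valK.
pose Q s := lin_Q (data (N s)); pose T s := lin_Y (data (N s)) + D.
have QT : \forall s \near t, [/\ Opos (Q s), lower (T s),
    (forall i, T s i i = D i i) & Q s *m N s = T s *m Q s].
  apply: filterS UN => s /(lin_data_ofP lam_decr); rewrite -/(data (N s)) /Q /T.
  case: (data _) => D1 Q1 Y1 L1 U1 Z1 /= [-> [[oQ pQ] hY] -> _ _].
  split=> //; [exact: lower_addD|by move=> i; exact: diag_addD|].
  by rewrite !mulmxA (mulmx1C oQ) mul1mx.
have [[oQ0 pQ0] lT0 dT0 QN0] := nbhs_singleton QT.
(* The number of coordinates after [i], so that row [i] of [B s] is supported on the coordinates up
   to [i]. *)
pose k (i : 'I_n) := (n - i.+1)%N.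
(* Normalizing constants that make the diagonal of [B t] equal to 1; they are products of
   differences of distinct entries of [D]. *)
pose b i := flag_poly c (k i) (T t) i i.
have b_neq0 i : b i != 0.
  rewrite /b flag_poly_diag//; apply/prodf_neq0 => j _; rewrite dT0.
  have jn : (n - j.+1 < n)%N.
    by rewrite ltn_subrL/= (leq_ltn_trans _ (ltn_ord i)).
  rewrite (cE (Ordinal jn)) subr_eq0; apply/eqP.
  move=> /(Dpi_inj lam_decr)/(congr1 (@nat_of_ord n))/= e.
  by have := ltn_ord j; have := ltn_ord i; move: e; rewrite /k; lia.
(* [Q] is frozen at time [t], so only [N s] varies and differentiability is immediate. *)
pose W s := \matrix_(i, j) ((b i)^-1 * (Q t *m flag_poly c (k i) (N s)) i j).
pose B s := \matrix_(i, j) ((b i)^-1 * (Q t *m (Q s)^T *m flag_poly c (k i) (T s)) i j).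
have WE : \forall s \near t, lower (B s) /\ W s = B s *m Q s.
  apply: filterS QT => s [[oQ _] lT dT QN]; split.
    apply/lowerP => i j ij; rewrite mxE mxE big1 ?mulr0// => l _.
    rewrite (flag_poly_eq0 (c := c)) ?mulr0 ?leq_subr//.
      by move=> a; rewrite cE.
    by have := ltn_ord i; rewrite /k; lia.
  apply/matrixP => i j; rewrite mxE [RHS]mxE.
  under eq_bigr do rewrite mxE -mulrA; rewrite -mulr_sumr; congr (_ * _).
  rewrite -[X in X *m flag_poly _ _ _]mulmx1 -oQ mulmxA -mulmxA.
  by rewrite (flag_poly_conj c (k i) QN) mulmxA mxE.
have W0 : pos_leading_minors (W t).
  have [lB ->] := nbhs_singleton WE.
  apply: pos_leading_minors_lower_mul => // i.
  by rewrite mxE (mulmx1C oQ0) mul1mx mulVf.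
have dW : derivable W t (1 : R).
  apply/derivable_entry => i j; under eq_fun do rewrite mxE.
  apply: derivable_mulr; first exact: derivable_cst.
  have h := derivable_mulmx (derivable_cst (Q t) t 1)
    (@derivable_flag_poly _ _ c (k i) _ _ dN).
  by have /derivable_entry := h; apply.
(* The minors are continuous in [s] and positive at [t]; positivity nearby then passes to the
   diagonal of [B s]. *)
have pW : \forall s \near t, pos_leading_minors (W s).
  suff h a : \forall s \near t, 0 < leading_minor (W s) a.
    have h' := @filter_forall _ _ (fun i s => 0 < leading_minor (W s) i) (nbhs t) _ h.
    exact: h'.
  have dm : derivable (fun s => leading_minor (W s) a) t (1 : R).
    apply: derivable_det; apply/derivable_entry => i j.
    under eq_fun do rewrite mxE.
    by have /derivable_entry := dW; apply.
  have := derivable_continuous dm => /cvgr_gt; apply; exact: W0.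
have [] := @derivable_QR _ _ (fun s => (W s)^T) (fun s => (Q s)^T) (fun s => (B s)^T) t.
- have h := derivable_trmx dW; exact: h.
- apply: filterS3 QT WE pW => s [[oQ pQ] _ _ _] [lB WEs] pWs; split.
  + by rewrite trmxK; exact: mulmx1C.
  + split=> [|i]; first exact: lower_tr.
    by rewrite mxE; apply: (pos_diag_of_minors lB pQ); rewrite -WEs.
  + by rewrite WEs trmx_mul.
- move=> h _; have := derivable_trmx h.
  by under eq_fun do rewrite trmxK.
Qed.

End Regularity.

(** * Rigidity of solutions *)

Section Rigidity.
Variables (R : realType) (n : nat) (lam : 'rV[R]_n) (pi : 'S_n).
Hypothesis lam_decr : forall i j : 'I_n, (i < j)%N -> lam 0 j < lam 0 i.
Variables (C : 'M[R]_n) (C_lower : lower C).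

Let D := Dpi lam pi.
Let data M := lin_data_of lam pi M.

Variables (N : R -> 'M[R]_n) (t : R).
Hypothesis UN : \forall s \near t, UGL lam pi (N s).
Hypothesis dN : is_derive t (1 : R) N
  (bracket (N t) (proj_skew (CQ lam pi (N t) C))).

Let Q s := lin_Q (data (N s)).
Let Y s := lin_Y (data (N s)).
Let L s := lin_L (data (N s)).
Let U s := lin_U (data (N s)).

Lemma near_data : \forall s \near t,
  [/\ (Q s)^T *m Q s = 1%:M, strictly_lower (Y s), N s = (Q s)^T *m (Y s + D) *m Q s &
      [/\ unit_lower (L s), upper_pos (U s) & Q s = L s *m U s]].
Proof.
apply: filterS UN => s /(lin_data_ofP lam_decr); rewrite -/(data (N s)) /Q /Y /L /U.
by case: (data _) => D1 Q1 Y1 L1 U1 Z1 /= [-> [[oQ _] hY] -> LU _].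
Qed.

Let A := proj_skew ((Q t)^T *m C *m Q t).

(* [S = Q' Q^T - Q A Q^T] is skew-symmetric and [[S, Y + D] = Y'] is strictly
   lower triangular, so [S] is lower triangular as well and vanishes. *)
Lemma rigidity_QY :
  is_derive t (1 : R) Q (Q t *m A) /\ is_derive t (1 : R) Y 0.
Proof.
have dNt : derivable N t (1 : R) by case: dN.
have /derivableP hQ := derivable_lin_Q lam_decr dNt UN.
set dQ := 'D_1 _ t in hQ; rewrite -/Q in hQ.
have [oQ hY NE _] := nbhs_singleton near_data.
have oQ2 := mulmx1C oQ.
have skA : A^T = - A by have [] := proj_skewP ((Q t)^T *m C *m Q t).
have skQ : dQ^T *m Q t + (Q t)^T *m dQ = 0.
  by apply: orthogonal_is_derive hQ; apply: filterS near_data => s [].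
(* The derivative of [Q N Q^T = Y + D] by the product rule, with the equation inserted for [N]. *)
pose dT := (dQ *m N t + Q t *m (N t *m A - A *m N t)) *m (Q t)^T + Q t *m N t *m dQ^T.
have hT : is_derive t (1 : R) (fun s => Q s *m N s *m (Q s)^T) dT.
  by apply: is_derive_mulmx (is_derive_trmx hQ); exact: is_derive_mulmx.
have hY' : is_derive t (1 : R) Y dT.
  have h0 := is_derive_cst D t 1.
  have h := is_deriveB hT h0; rewrite subr0 in h.
  apply: near_is_derive h; apply: filterS near_data => s [oQs _ NsE _].
  have oQs2 := mulmx1C oQs; rewrite !fctE /= NsE.
  by rewrite !mulmxA oQs2 mul1mx -mulmxA oQs2 mulmx1 addrK.
have lT (i j : 'I_n) : (i <= j)%N -> dT i j = 0.
  move=> ij; have /is_derive_mxP/(_ i j) h := hY'.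
  apply: (near_cst_is_derive _ h); apply: filterS near_data => s [_ hYs _ _].
  exact: hYs.
have TE : Q t *m N t *m (Q t)^T = Y t + D.
  by rewrite NE !mulmxA oQ2 mul1mx -mulmxA oQ2 mulmx1.
have [S SE] : exists S, S = (dQ - Q t *m A) *m (Q t)^T by eexists.
have dQE : dQ = S *m Q t + Q t *m A.
  by rewrite SE -mulmxA oQ mulmx1 subrK.
have skS : S^T = - S.
  (* Conjugated by [Q], [S] is a difference of two skew-symmetric matrices. *)
  have e : (Q t)^T *m S *m Q t = (Q t)^T *m dQ - A.
    by rewrite SE mulmxA -mulmxA oQ mulmx1 mulmxBr mulmxA oQ mul1mx.
  have e' : (Q t)^T *m S^T *m Q t = - ((Q t)^T *m S *m Q t).
    have /(congr1 trmx) := e; rewrite trmx_mul trmx_mul trmxK mulmxA => ->.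
    rewrite e linearB/= skA trmx_mul trmxK opprB opprK addrC; congr (_ + _).
    by apply/eqP; rewrite -addr_eq0 skQ.
  have inj X : Q t *m ((Q t)^T *m X *m Q t) *m (Q t)^T = X.
    by rewrite !mulmxA oQ2 mul1mx -mulmxA oQ2 mulmx1.
  by rewrite -[LHS]inj e' mulmxN mulNmx inj.
have dTE : dT = S *m (Y t + D) - (Y t + D) *m S.
  have dQtE : dQ^T = - ((Q t)^T *m S) - A *m (Q t)^T.
    by rewrite dQE linearD/= !trmx_mul skS skA mulmxN mulNmx.
  rewrite /dT dQtE dQE -TE !(mulmxDl, mulmxDr, mulmxN, mulNmx, mulmxA).
  rewrite -!addrA; congr (_ + _).
  by rewrite addrCA addNKr addrC subrK.
have lS : lower S.
  apply: (sylvester_Dpi (pi := pi) lam_decr (T := Y t + D) (T' := Y t + D)).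
  - exact: lower_addD.
  - exact: lower_addD.
  - by move=> i; exact: diag_addD.
  - by move=> i; exact: diag_addD.
  by move=> i j ij; rewrite -dTE lT// ltnW.
have S0 : S = 0.
  have skE i j : S i j = - S j i by have /matrixP/(_ j i) := skS; rewrite !mxE.
  apply/matrixP => i j; rewrite [RHS]mxE; case: (ltngtP i j) => [ij|ji|/val_inj <-].
  - exact: (lowerP _).1.
  - by rewrite skE (lowerP S).1 ?oppr0.
  - by have /eqP := skE i i; rewrite -addr_eq0 -mulr2n mulrn_eq0 /= => /eqP.
split; first by move: hQ; rewrite dQE S0 mul0mx add0r.
by move: hY'; rewrite dTE S0 mul0mx mulmx0 subr0.
Qed.

(** Differentiating [L = Q U^-1] gives [L' = C L + L F] with [F] upper triangular, while
    [F = L^-1 L' - L^-1 C L] is lower triangular. So [F] is diagonal, and since [L'] has zero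
    diagonal, [F = - diag C]. *)
Lemma rigidity_L : is_derive t (1 : R) L (C *m L t - L t *m diag_part C).
Proof.
have [hQ _] := rigidity_QY.
have LU : \forall s \near t,
    [/\ unit_lower (L s), upper_pos (U s) & Q s = L s *m U s].
  by apply: filterS near_data => s [].
have dQ : derivable Q t (1 : R) by case: hQ.
have [dL dU] := derivable_LU dQ LU.
have uU : \forall s \near t, U s \in unitmx.
  by apply: filterS LU => s [_ hU _]; exact: upper_pos_unit.
have /derivableP hV := derivable_invmx uU dU.
set dV := 'D_1 _ t in hV.
have /derivableP hL := dL; set dl := 'D_1 _ t in hL.
have [oQ _ _ [hLt hUt QE]] := nbhs_singleton near_data.
have uUt := upper_pos_unit hUt; have uLt := unit_lower_unit hLt.
have dlE : dl = Q t *m A *m invmx (U t) + Q t *m dV.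
  apply: is_derive_unique hL _; apply: near_is_derive (is_derive_mulmx hQ hV).
  by apply: filterS LU => s [_ hU ->]; rewrite mulmxK// upper_pos_unit.
have udV : upper dV.
  apply: upper_is_derive hV; apply: filterS LU => s [_ /upper_pos_inv[] //].
have sdl (i j : 'I_n) : (i <= j)%N -> dl i j = 0.
  move=> ij; have /is_derive_mxP/(_ i j) h := hL.
  apply: (@near_cst_is_derive _ _ (i == j)%:R _ _ _ h).
  apply: filterS LU => s [[lL d1] _ _].
  move: ij; rewrite leq_eqVlt => /orP[/eqP/val_inj <-|ij]; first by rewrite eqxx d1.
  by rewrite (lowerP (L s)).1// -val_eqE ltn_eqF.
have [_ uE] := proj_skewP ((Q t)^T *m C *m Q t); rewrite -/A in uE.
have [E EE] : exists E, E = (Q t)^T *m C *m Q t - A by eexists.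
rewrite -EE in uE.
have [F FE] : exists F, F = U t *m (dV - E *m invmx (U t)) by eexists.
have dlE2 : dl = C *m L t + L t *m F.
  have AE : A = (Q t)^T *m C *m Q t - E by rewrite EE opprB addrC subrK.
  rewrite dlE AE mulmxBr mulmxBl !mulmxA (mulmx1C oQ) mul1mx.
  rewrite -(mulmxA C) {1}QE mulmxK// -addrA; congr (_ + _).
  by rewrite FE (mulmxA (L t)) -QE mulmxBr (mulmxA _ E) addrC.
have uF : upper F.
  have [uUU _] := hUt; have [uiU _] := upper_pos_inv hUt.
  rewrite FE; apply: upper_mul => //; rewrite /upper linearB/=.
  by apply: lowerD => //; apply: lowerN; exact: upper_mul.
have FE2 : F = invmx (L t) *m dl - invmx (L t) *m C *m L t.
  by rewrite dlE2 mulmxDr (mulmxA _ C) mulKmx// addrC addKr.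
have [lL d1] := hLt; have [lLi di1] := unit_lower_inv hLt.
have ldl : lower dl by apply/lowerP => i j /ltnW; exact: sdl.
have lLiC := lower_mul lLi C_lower.
have lF : lower F.
  rewrite FE2; apply: lowerD; first exact: lower_mul.
  by apply: lowerN; exact: lower_mul.
suff FD : F = - diag_part C by apply: is_derive_eq hL _; rewrite dlE2 FD mulmxN.
apply/matrixP => i j; case: (ltngtP i j) => [ij|ji|/val_inj <-].
- by rewrite (lowerP F).1// mxE (lowerP (diag_part C)).1 ?oppr0//; exact: lower_diag_part.
- rewrite (upperP F).1// !mxE -val_eqE gtn_eqF// mulr0n oppr0//.
- rewrite [RHS]mxE diag_part_diag FE2 mxE [X in _ + X]mxE.
  rewrite (lower_mul_diag i lLi ldl) (lower_mul_diag i lLiC lL).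
  rewrite (lower_mul_diag i lLi C_lower) di1 d1 sdl// mul1r mulr1 mul1r add0r//.
Qed.

End Rigidity.

(** * Uniqueness and global existence *)

Lemma lower_flow_unique (R : realType) (n : nat) (C : 'M[R]_n) (J : set R)
    (L : R -> 'M[R]_n) : is_interval J -> J 0 ->
  (forall t, J t -> is_derive t (1 : R) L (C *m L t - L t *m diag_part C)) ->
  forall t, J t -> L t = lower_flow C (L 0) t.
Proof.
move=> itJ J0 hL t Jt.
(* Undoing the explicit flow: [G] has zero derivative and equals [L 0] at time 0. *)
pose G s := mexp (- s *: C) *m L s *m mexp (s *: diag_part C).
have GE : G t = G 0.
  apply: (is_derive0_cst_mx_itv itJ) => // s Js.
  have h1 := is_derive_mulmx (is_derive_mexpN s C) (hL s Js).
  apply: is_derive_eq (is_derive_mulmx h1 (is_derive_mexp s (diag_part C))) _.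
  rewrite -(mexp_comm (diag_part C)) mulmxBr mulNmx !mulmxA addKr mulNmx addNr//.
rewrite /lower_flow; have -> : L 0 = G t.
  by rewrite GE /G oppr0 !scale0r !mexp0 mulmx1 mul1mx.
by rewrite /G !mulmxA mexpKN mul1mx -mulmxA mexpKN mulmx1.
Qed.

(** Openness of [J] lets the rigidity lemmas apply at each of its points; the interval property
    turns zero derivatives into constancy. *)
Lemma solution_lin_data (R : realType) (n : nat) (lam : 'rV[R]_n) (pi : 'S_n)
    (lam_decr : forall i j : 'I_n, (i < j)%N -> lam 0 j < lam 0 i)
    (C M0 : 'M[R]_n) (J : set R) (N : R -> 'M[R]_n) : lower C ->
  is_interval J -> open J -> J 0 -> solves lam pi C M0 J N ->
  forall t, J t -> lin_Y (lin_data_of lam pi (N t)) = lin_Y (lin_data_of lam pi M0) /\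
    lin_L (lin_data_of lam pi (N t)) =
      lower_flow C (lin_L (lin_data_of lam pi M0)) t.
Proof.
move=> lC itJ oJ J0 [<- hN] t Jt.
have UN s : J s -> \forall u \near s, UGL lam pi (N u).
  move=> Js; have : nbhs s J by apply: open_nbhs_nbhs.
  by apply: filterS => u /hN[].
split.
  apply: (is_derive0_cst_mx_itv
    (A := fun s => lin_Y (lin_data_of lam pi (N s))) itJ) => // s Js.
  by have [_ dN] := hN s Js; have [] := rigidity_QY lam_decr (UN s Js) dN.
apply: (lower_flow_unique
  (L := fun s => lin_L (lin_data_of lam pi (N s))) itJ) => // s Js.
by have [_ dN] := hN s Js; exact: (rigidity_L lam_decr lC (UN s Js) dN).
Qed.

(** The second clause justifies speaking of the solution; the third excludes that [d t] is the
    default value of [lin_data_of]. *)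
Theorem proposition5p1 (R : realType) (n : nat) (lam : 'rV[R]_n) (pi : 'S_n)
    (lam_decr : forall i j : 'I_n, (i < j)%N -> lam 0 j < lam 0 i)
    (C M0 : 'M[R]_n) (C_lower : lower C) (M0_in : UGL lam pi M0) :
  exists M : R -> 'M[R]_n,
    let d t := lin_data_of lam pi (M t) in
    [/\ solves lam pi C M0 setT M,
        forall (J : set R) (N : R -> 'M[R]_n),
          is_interval J -> open J -> J 0 -> solves lam pi C M0 J N ->
          forall t, J t -> N t = M t,
        forall t, is_lin_data lam pi (M t) (d t) &
        forall t,
          [/\ lin_D (d t) = lin_D (d 0),
              lin_Y (d t) = lin_Y (d 0),
              lin_Z (d t) + Dpi lam pi =
                invmx (lin_L (d t)) *m (lin_Y (d 0) + Dpi lam pi)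
                  *m lin_L (d t) &
              lin_L (d t) =
                mexp (t *: C) *m lin_L (d 0) *m mexp (- t *: diag_part C)]].
Proof.
have [[D0 Q0 Y0 L0 U0 Z0] hd0] := UGL_lin_data M0_in.
have := hd0 => -[_ [[oQ0 _] hY0] M0E [hL0 hU0 Q0E] _].
have hLt := unit_lower_flow C_lower hL0.
(* The QR factors of the flow, selected simultaneously for all times; by uniqueness of the
   factorization they are smooth enough to be differentiated below. *)
have /choice[f hf] t : exists QS : 'M[R]_n * 'M[R]_n,
    [/\ QS.1^T *m QS.1 = 1%:M, upper_pos QS.2 & lower_flow C L0 t = QS.1 *m QS.2].
  have [Q [S QS]] := QR_exists (unit_lower_unit (hLt t)).
  by exists (Q, S).
pose Q t := (f t).1; pose S t := (f t).2.
have {}hf t : [/\ (Q t)^T *m Q t = 1%:M, upper_pos (S t) &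
    lower_flow C L0 t = Q t *m S t] by exact: hf.
pose L t := lower_flow C L0 t.
pose D := Dpi lam pi.
(* From [L = Q S] one reads [Q = L S^-1], so the upper factor of [Q t] is the inverse of [S t]. *)
pose d t := LinData D (Q t) Y0 (L t) (invmx (S t)) (invmx (L t) *m (Y0 + D) *m L t - D).
pose M t := (Q t)^T *m (Y0 + D) *m Q t.
have hd t : is_lin_data lam pi (M t) (d t).
  have [oQ hS LE] := hf t.
  apply: is_lin_data_intro => //; first exact: upper_pos_inv.
  by rewrite /L LE mulmxK// upper_pos_unit.
have dE t := lin_data_of_eq lam_decr (hd t).
have M0E' : M 0 = M0.
  have [oQ hS LE] := hf 0.
  have [QQ _] : Q 0 = Q0 /\ S 0 = invmx U0.
    apply: QR_unique => //; first exact: upper_pos_inv.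
    by rewrite -LE lower_flow0 Q0E mulmxK// upper_pos_unit.
  by move: hd0 => [DE _ ME _ _]; rewrite /M QQ ME DE.
exists M; split.
(* Keeping the coordinate [Y0] of [M0] is enough for [M t] to stay in [UGL]. *)
- split=> // t _; split; first exact: (UGL_same_Y lam_decr M0_in hd0 (hd t) (erefl _)).
  have nf : \forall s \near t, [/\ (Q s)^T *m Q s = 1%:M, upper_pos (S s) &
      lower_flow C L0 s = Q s *m S s] by exists 1; [exact: ltr01|move=> s _; exact: hf].
  have hQ := is_derive_QR nf (is_derive_lower_flow C L0 t).
  rewrite /CQ dE/=; apply: is_derive_conj hQ.
  by have [] := proj_skewP ((Q t)^T *m C *m Q t).
- move=> J N itJ oJ J0 hN t Jt.
  have [] := solution_lin_data lam_decr C_lower itJ oJ J0 hN Jt.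
  have [_ /(_ t Jt)[UNt _]] := hN.
  have := lin_data_ofP lam_decr UNt; rewrite (lin_data_of_eq lam_decr hd0)/=.
  case: (lin_data_of lam pi (N t)) => D1 Q1 Y1 L1 U1 Z1.
  move=> [-> [[oQ1 _] _] -> [_ hU1 Q1E] _] /= -> L1E.
  have [oQ hS LE] := hf t.
  (* The data of [N t] and of [M t] share [Y0] and the matrix [L], whose QR factorization determines
     the orthogonal factor. *)
  have [-> //] : Q1 = Q t /\ invmx U1 = S t.
  apply: QR_unique => //; first exact: upper_pos_inv.
  by rewrite -LE -L1E Q1E mulmxK// upper_pos_unit.
- by move=> t; rewrite dE.
- move=> t; rewrite !dE /= /L lower_flow0; split=> //.
  by rewrite subrK.
Qed.
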